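(* For all real $z>0$ the following identities hold: $$\operatorname{lsh}_3^{(1)}(z)=-\frac{z}{4}\left(\operatorname{Li}_2(1-e^{2z})-\operatorname{Li}_2(1-e^{-2z})\right)+\frac14\left(\operatorname{Li}_3(1-e^{2z})+\operatorname{Li}_3(1-e^{-2z})\right),$$ $$\operatorname{lsh}_4^{(1)}(z)=\frac{z^4}{4}+\frac{z}{2}\left(\operatorname{Li}_3(1-e^{2z})-\operatorname{Li}_3(1-e^{-2z})\right)-\frac12\left(\operatorname{Li}_4(1-e^{2z})+\operatorname{Li}_4(1-e^{-2z})\right),$$ $$\begin{aligned}\operatorname{lsh}_5^{(1)}(z)&=\frac{z^5}{5}-\frac{3z^4}{4}\log(2\sinh z)-\frac38\zeta(5)+\frac{3z^2}{4}\zeta(3)-z^3\zeta(2)\\&\quad+\frac{3z}{4}\left(\operatorname{Li}_4(e^{-2z})-2\operatorname{Li}_4(1-e^{2z})+2\operatorname{Li}_4(1-e^{-2z})\right)\\&\quad+\frac38\left(\operatorname{Li}_5(e^{-2z})+4\operatorname{Li}_5(1-e^{2z})+4\operatorname{Li}_5(1-e^{-2z})\right),\end{aligned}$$ $$\operatorname{lsh}_3^{(0)}(z)=\frac{z^3}{3}+\frac12\left(\operatorname{Li}_3(1-e^{2z})-\operatorname{Li}_3(1-e^{-2z})\right),$$ $$\begin{aligned}\operatorname{lsh}_4^{(0)}(z)&=\frac34\left(\operatorname{Li}_4(e^{-2z})-2\operatorname{Li}_4(1-e^{2z})+2\operatorname{Li}_4(1-e^{-2z})\right)+\frac{z^4}{4}-z^3\log(2\sinh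 z)\\&\quad-\frac34\zeta(4)+\frac{3z}{2}\zeta(3)-\frac{3z^2}{2}\zeta(2).\end{aligned}$$
   Context: For integers $0\le k<m$, the normalized log-sinh integral is $$\operatorname{lsh}_m^{(k)}(z)=-\int_0^z t^k\left(\log\frac{\sinh t}{\sinh z}\right)^{m-1-k}dt.$$ $\zeta$ is the Riemann zeta function. $\operatorname{Li}_m(x)=\sum_{n\ge1}x^n n^{-m}$ for $|x|<1$ is the polylogarithm, extended by analytic continuation to $\mathbb{C}\setminus[1,\infty)$ (principal branch); it is real for real $x<1$. *)

(* Defs.v *)
From Stdlib Require Import Reals ClassicalEpsilon.
From Coquelicot Require Import Coquelicot.
Open Scope R_scope.

(* The integral is improper at 0: for k = 0 the integrand is unbounded there.
   Meaningful for k < m only, because m - 1 - k is truncated. *)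
Definition lsh (m k : nat) (z : R) : R :=
  - RInt_gen (fun t => t ^ k * ln (sinh t / sinh z) ^ (m - 1 - k))
      (at_right 0) (at_point z).

(* The Riemann zeta function on its half-line of convergence 1 < s. *)
Definition zeta (s : R) : R := Series (fun n => / Rpower (INR (S n)) s).

Definition analytic_at (f : C -> C) (x0 : C) : Prop :=
  exists (r : R) (a : nat -> C), 0 < r /\
    forall x : C, Cmod (x - x0)%C < r ->
      @is_pseries C_AbsRing C_NormedModule a (x - x0)%C (f x).

Definition slit_plane (x : C) : Prop := ~ (Im x = 0 /\ 1 <= Re x).

Definition is_polylog (m : nat) (f : C -> C) : Prop :=
  (forall x : C, slit_plane x -> analytic_at f x) /\
  (forall x : C, Cmod x < 1 ->
     @is_series C_AbsRing C_NormedModule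
       (fun n => (x ^ S n / RtoC (INR (S n)) ^ m)%C) (f x)).

(* The slit plane is connected, so [is_polylog m] determines the values on it
   (and only those) uniquely. *)
Definition Li (m : nat) : C -> C :=
  epsilon (inhabits (fun _ : C => RtoC 0)) (is_polylog m).

(* Main.v *)
Require Import Defs.
From Stdlib Require Import Reals Factorial Lra Lia Classical ClassicalEpsilon.
From Coquelicot Require Import Coquelicot.
Open Scope R_scope.

(** Why the five identities hold.

    Fix [k] and write [u t = ln (sinh t / sinh z)], so that [u' = coth] and
    [u z = 0].  Suppose that [e 0], [e 1], ... are functions on the positive
    half-line with [e 0 t = t ^ S k / INR (S k)], [e (S j)' = coth * e j], and
    [e (S j) t -> 0] as [t -> 0+].  Integrating by parts [p] times turns
    the integral of [t ^ k * u t ^ p] into [(-1) ^ p * p! * e p z]: each step moves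
    a factor [coth] from [u ^ p] onto [e j], and the boundary terms vanish, at [z]
    because [u z = 0] and at [0] because [e j] is [O(t)] whereas [u] is only
    logarithmic.  This is [log_sinh_integral], and [lsh_eq] restates it for [lsh].
    No differentiation with respect to the upper bound is involved.

    It remains to see that the right-hand sides, suitably rescaled, form such
    sequences [e].  Put [A_m = Li_m (1 - exp (2 z))], [B_m = Li_m (1 - exp (-2 z))]
    and [C_m = Li_m (exp (-2 z))].  From [x * Li_(m+1)' x = Li_m x] one gets
    [A_(m+1)' = (coth + 1) A_m], [B_(m+1)' = (coth - 1) B_m],
    [C_(m+1)' = -2 C_m].  Differentiating the right-hand sides then leaves
    exactly the terms of two classical functional equations,
    Landen's relation [A_2 + B_2 = - 2 z ^ 2] ([dilog_two_term]) and the three-term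
    relation for [A_3 + B_3 + C_3] ([trilog_three_term]).  These are proved
    by the same method: the derivative of the difference of the two sides is zero
    and its limit at [0+] is known.  The zeta values enter only as the limits of
    [C_m] at [0+], by Abel's theorem ([Abel_limit_of_nonneg]).

    Since [Li] is chosen by [epsilon], existence and uniqueness of the analytic
    continuation must both be proved.  Existence: with the probability density
    [weight p] on [0, 1], the integral of [weight p s * x / (1 - s ^ 2 * x)] is
    a function of [x] that is analytic on the slit plane, because the geometric
    series for the kernel converges uniformly in [s], and whose
    Taylor coefficients at [0] are the moments [1 / (n + 1) ^ (p + 1)]
    ([polylog_is_polylog]).  Uniqueness is needed on the real half-line only, where it
    follows from the identity theorem for power series and the completeness of the reals
    ([is_polylog_unique]).  The same integral gives
    the derivative rule, by an integration by parts in [s] ([moment_kernel_sqr]).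

    Throughout, an index [p] of [weight], [moment], [polylog] and their relatives
    stands for the order [S p]. *)

(* Replaces the operations of abstract modules and rings by those of the reals, which is the
   form that [ring], [field] and [lra] recognise. *)
Ltac in_R :=
  match goal with |- @eq _ ?a ?b => change (@eq R a b) end;
  repeat match goal with
  | |- context [@plus ?G ?a ?b] => change (@plus G a b) with (Rplus a b)
  | |- context [@minus ?G ?a ?b] => change (@minus G a b) with (Rminus a b)
  | |- context [@opp ?G ?a] => change (@opp G a) with (Ropp a)
  | |- context [@mult ?G ?a ?b] => change (@mult G a b) with (Rmult a b)
  | |- context [@scal ?K ?V ?a ?b] => change (@scal K V a b) with (Rmult a b)
  | |- context [@zero ?G] => change (@zero G) with 0
  | |- context [@one ?K] => change (@one K) with 1
  end.

(** * Powers of the logarithm near zero, and a fundamental theorem of calculus *)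

(** With [x = - ln s] this is [x ^ k / k! <= exp x], one term of the exponential series. *)
Lemma mul_ln_pow_le_fact (k : nat) (s : R) :
  0 < s <= 1 -> s * Rabs (ln s) ^ k <= INR (fact k).
Proof.
  intros [H0 H1].
  assert (Hl : ln s <= 0) by (rewrite <- ln_1; apply ln_le; lra).
  rewrite (Rabs_left1 _ Hl).
  assert (Hx : 0 <= - ln s) by lra.
  assert (Hf : 0 < INR (fact k)) by apply INR_fact_lt_0.
  assert (Hk : (- ln s) ^ k / INR (fact k) <= exp (- ln s)).
  { apply Rle_trans with (2 := exp_ge_taylor (- ln s) k Hx).
    assert (Hpos : forall j, 0 <= (- ln s) ^ j / INR (fact j)).
    { intros j. apply Rdiv_le_0_compat. now apply pow_le. apply INR_fact_lt_0. }
    destruct k as [|k]; simpl sum_f_R0.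
    - apply Rle_refl.
    - apply Rle_trans with (0 + (- ln s) ^ S k / INR (fact (S k))).
      + rewrite Rplus_0_l. apply Rle_refl.
      + apply Rplus_le_compat_r. apply cond_pos_sum. intros j. apply Hpos. }
  rewrite exp_Ropp, exp_ln in Hk by assumption.
  apply Rmult_le_reg_r with (/ INR (fact k) * / s).
  { apply Rmult_lt_0_compat; apply Rinv_0_lt_compat; assumption. }
  replace (INR (fact k) * (/ INR (fact k) * / s)) with (/ s) by (field; lra).
  replace (s * (- ln s) ^ k * (/ INR (fact k) * / s))
    with ((- ln s) ^ k / INR (fact k)) by (field; lra).
  exact Hk.
Qed.

(** The preceding bound applied to [sqrt s]; the second factor [sqrt s] makes the right-hand side
    tend to zero. *)
Lemma mul_ln_pow_le_sqrt (k : nat) (s : R) :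
  0 < s <= 1 -> Rabs (s * ln s ^ k) <= 2 ^ k * INR (fact k) * sqrt s.
Proof.
  intros [H0 H1].
  assert (Hq : 0 < sqrt s) by now apply sqrt_lt_R0.
  assert (Hs : sqrt s * sqrt s = s) by (apply sqrt_sqrt; lra).
  assert (Hln : ln s = 2 * ln (sqrt s)).
  { rewrite <- Hs at 1. rewrite ln_mult by assumption. ring. }
  rewrite Rabs_mult, <- RPow_abs, Hln, Rabs_mult, (Rabs_pos_eq 2), Rpow_mult_distr by lra.
  rewrite (Rabs_pos_eq s) by lra. rewrite <- Hs at 1.
  assert (Hq1 : sqrt s <= 1) by (rewrite <- sqrt_1; apply sqrt_le_1; lra).
  assert (H := mul_ln_pow_le_fact k (sqrt s) (conj Hq Hq1)).
  replace (sqrt s * sqrt s * (2 ^ k * Rabs (ln (sqrt s)) ^ k))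
    with (2 ^ k * (sqrt s * Rabs (ln (sqrt s)) ^ k) * sqrt s) by ring.
  apply Rmult_le_compat_r; [lra|].
  apply Rmult_le_compat_l; [|exact H]. apply pow_le; lra.
Qed.

Lemma at_right_between (a b : R) : a < b -> at_right a (fun t => a < t < b).
Proof.
  intros Hab. assert (Hd : 0 < b - a) by lra.
  exists (mkposreal _ Hd). intros t Ht Hat. split; [exact Hat|].
  unfold ball in Ht; simpl in Ht; unfold AbsRing_ball, abs, minus, plus, opp in Ht; simpl in Ht.
  apply Rabs_def2 in Ht. lra.
Qed.

Lemma filterlim_0_of_abs_le {T : Type} (F : (T -> Prop) -> Prop) (FF : Filter F)
    (f g : T -> R) :
  F (fun t => Rabs (f t) <= g t) -> filterlim g F (locally 0) ->
  filterlim f F (locally 0).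
Proof.
  intros Hle Hg. apply filterlim_locally. intros eps.
  assert (Hge := proj1 (filterlim_locally g 0) Hg eps).
  generalize (filter_and _ _ Hle Hge). apply filter_imp. intros t [H1 H2].
  unfold ball in *; simpl in *; unfold AbsRing_ball, abs, minus, plus, opp in *; simpl in *.
  rewrite Ropp_0, Rplus_0_r in *. apply Rle_lt_trans with (1 := H1).
  apply Rle_lt_trans with (2 := H2). apply Rle_abs.
Qed.

Lemma filterlim_at_right_of_continuous (f : R -> R) (a l : R) :
  continuous f a -> f a = l -> filterlim f (at_right a) (locally l).
Proof.
  intros Hf <-. eapply filterlim_filter_le_1; [|exact Hf].
  apply filter_le_within.
Qed.

Lemma filterlim_mul_ln_pow (k : nat) :
  filterlim (fun s => s * ln s ^ k) (at_right 0) (locally 0).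
Proof.
  apply (filterlim_0_of_abs_le _ _ _ (fun s => 2 ^ k * INR (fact k) * sqrt s)).
  - generalize (at_right_between 0 1 Rlt_0_1). apply filter_imp.
    intros s Hs. apply mul_ln_pow_le_sqrt. lra.
  - apply filterlim_at_right_of_continuous.
    + apply (continuous_scal_r (V := R_NormedModule) (2 ^ k * INR (fact k)) sqrt).
      apply continuous_sqrt.
    + rewrite sqrt_0. ring.
Qed.

Lemma ln_nonpos (s : R) : s <= 0 -> ln s = 0.
Proof.
  intros Hs. unfold ln. destruct (Rlt_dec 0 s); [exfalso; lra|reflexivity].
Qed.

(** Continuity at [0] is two-sided: it uses that [ln] takes the value [0] on nonpositive
    arguments.  It lets the logarithmic density be treated by proper integrals. *)
Lemma continuous_mul_ln_pow (k : nat) (s : R) :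
  0 <= s -> continuous (fun s => s * ln s ^ k) s.
Proof.
  intros [Hs| <-].
  - apply (ex_derive_continuous (fun s => s * ln s ^ k)). auto_derive. exact Hs.
  - unfold continuous. rewrite Rmult_0_l.
    apply (filterlim_0_of_abs_le _ _ _
             (fun s => 2 ^ k * INR (fact k) * sqrt s + Rabs s)).
    + exists (mkposreal 1 Rlt_0_1). intros s Hs.
      unfold ball in Hs; simpl in Hs; unfold AbsRing_ball, abs, minus, plus, opp in Hs; simpl in Hs.
      apply Rabs_def2 in Hs. destruct (Rlt_le_dec 0 s) as [Hp|Hn].
      * assert (H1 : 0 < s <= 1) by lra.
        assert (H2 := mul_ln_pow_le_sqrt k s H1).
        assert (H := Rabs_pos s). lra.
      * rewrite ln_nonpos by exact Hn.
        apply Rle_trans with (Rabs s).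
        -- rewrite Rabs_mult. rewrite <- (Rmult_1_r (Rabs s)) at 2.
           apply Rmult_le_compat_l; [apply Rabs_pos|].
           destruct k as [|k]; simpl; rewrite ?Rmult_0_l, ?Rabs_R0, ?Rabs_R1; lra.
        -- assert (H : 0 <= 2 ^ k * INR (fact k) * sqrt s).
           { apply Rmult_le_pos; [|apply sqrt_pos].
             apply Rmult_le_pos; [apply pow_le; lra | apply pos_INR]. }
           lra.
    + assert (Hc : continuous (fun s => 2 ^ k * INR (fact k) * sqrt s + Rabs s) 0).
      { apply (continuous_plus (V := R_NormedModule)).
        - apply (continuous_scal_r (V := R_NormedModule) (2 ^ k * INR (fact k)) sqrt).
          apply continuous_sqrt.
        - apply continuous_Rabs. }
      unfold continuous in Hc. rewrite sqrt_0, Rabs_R0, Rmult_0_r, Rplus_0_r in Hc.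
      exact Hc.
Qed.

(** The antiderivative may fail to be differentiable at [0], as happens for
    those containing powers of [ln]: the integral over [[0, e]] is [O(e)], so it suffices to let
    [e] tend to zero in the identity on [[e, 1]]. *)
Lemma RInt_of_antiderivative (F f : R -> R) :
  (forall x, 0 < x <= 1 -> is_derive F x (f x)) ->
  continuous F 0 ->
  (forall x, 0 <= x <= 1 -> continuous f x) ->
  RInt f 0 1 = F 1 - F 0.
Proof.
  intros HF HF0 Hf.
  assert (Hex : forall a b, 0 <= a <= b -> b <= 1 -> ex_RInt f a b).
  { intros a b Hab Hb. apply (ex_RInt_continuous (V := R_CompleteNormedModule)).
    intros x. rewrite Rmin_left, Rmax_right by lra. intros Hx. apply Hf. lra. }
  destruct (continuity_ab_maj (fun x => Rabs (f x)) 0 1 ltac:(lra)) as [M [HM _]].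
  { intros x Hx. apply continuity_pt_filterlim.
    apply (continuous_comp f Rabs); [now apply Hf | apply continuous_Rabs]. }
  assert (Hlim : filterlim (fun e => RInt f 0 1 - (F 1 - F e)) (at_right 0) (locally 0)).
  { apply (filterlim_0_of_abs_le _ _ _ (fun e => e * Rabs (f M))).
    - generalize (at_right_between 0 1 Rlt_0_1). apply filter_imp. intros e He.
      rewrite <- (RInt_Chasles f 0 e 1) by (apply Hex; lra).
      rewrite (is_RInt_unique f e 1 (F 1 - F e)).
      + change (Rabs (RInt f 0 e + (F 1 - F e) - (F 1 - F e)) <= e * Rabs (f M)).
        assert (Hc : forall u v : R, u + v - v = u) by (intros; ring).
        rewrite Hc. replace e with (e - 0) at 2 by ring.
        apply abs_RInt_le_const; [lra | apply Hex; lra |].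
        intros t Ht. apply HM. lra.
      + apply (is_RInt_derive (V := R_CompleteNormedModule) F f);
          rewrite Rmin_left, Rmax_right by lra; intros x Hx.
        * apply HF. lra.
        * apply Hf. lra.
    - apply filterlim_at_right_of_continuous; [|ring].
      apply (ex_derive_continuous (fun e => e * Rabs (f M))). auto_derive. exact I. }
  assert (Hlim' : filterlim (fun e => RInt f 0 1 - (F 1 - F e)) (at_right 0)
                    (locally (RInt f 0 1 - (F 1 - F 0)))).
  { apply filterlim_at_right_of_continuous; [|reflexivity].
    apply (continuous_minus (V := R_NormedModule)); [apply continuous_const|].
    apply (continuous_minus (V := R_NormedModule)); [apply continuous_const|].
    exact HF0. }
  assert (H := filterlim_locally_unique _ _ _ Hlim Hlim').
  lra.
Qed.

(** * The moments of a logarithmic density on the unit interval *)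

(** The density [(- ln t) ^ p / p!] of the Mellin representation of [1 / n ^ (p + 1)], after the
    substitution [t = s ^ 2], which makes it continuous at the origin. *)
Definition weight (p : nat) (s : R) : R := 2 * s * (-2 * ln s) ^ p / INR (fact p).

Lemma continuous_weight (p : nat) (s : R) : 0 <= s -> continuous (weight p) s.
Proof.
  intros Hs.
  apply continuous_ext with (fun s => 2 * (-2) ^ p / INR (fact p) * (s * ln s ^ p)).
  - intros t. in_R. unfold weight. rewrite Rpow_mult_distr. field. apply INR_fact_neq_0.
  - apply (continuous_scal_r (V := R_NormedModule) _ (fun s => s * ln s ^ p)).
    now apply continuous_mul_ln_pow.
Qed.

Lemma weight_ge_0 (p : nat) (s : R) : 0 <= s <= 1 -> 0 <= weight p s.
Proof.
  intros Hs. unfold weight. apply Rdiv_le_0_compat; [|apply INR_fact_lt_0].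
  apply Rmult_le_pos; [lra|]. apply pow_le.
  destruct (Rle_lt_dec s 0) as [H|H].
  - rewrite ln_nonpos by exact H. lra.
  - assert (ln s <= 0) by (rewrite <- ln_1; apply ln_le; lra). lra.
Qed.

Lemma continuous_sqr_comp (g : R -> R) :
  (forall t, 0 <= t <= 1 -> continuous g t) ->
  forall s, 0 <= s <= 1 -> continuous (fun s => g (s ^ 2)) s.
Proof.
  intros Hg s Hs. apply (continuous_comp (fun s => s ^ 2) g).
  - apply (ex_derive_continuous (fun s => s ^ 2)). auto_derive. exact I.
  - apply Hg. nra.
Qed.

Lemma continuous_weight_mul (p : nat) (g : R -> R) :
  (forall t, 0 <= t <= 1 -> continuous g t) ->
  forall s, 0 <= s <= 1 -> continuous (fun s => weight p s * g (s ^ 2)) s.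
Proof.
  intros Hg s Hs. apply (continuous_mult (weight p) (fun s => g (s ^ 2))).
  - apply continuous_weight. lra.
  - now apply continuous_sqr_comp.
Qed.

Lemma ex_RInt_weight (p : nat) (g : R -> R) :
  (forall t, 0 <= t <= 1 -> continuous g t) ->
  ex_RInt (fun s => weight p s * g (s ^ 2)) 0 1.
Proof.
  intros Hg. apply (ex_RInt_continuous (V := R_CompleteNormedModule)).
  rewrite Rmin_left, Rmax_right by lra. now apply continuous_weight_mul.
Qed.

Definition moment (p : nat) (g : R -> R) : R := RInt (fun s => weight p s * g (s ^ 2)) 0 1.

Lemma moment_ext (p : nat) (g h : R -> R) :
  (forall t, 0 <= t <= 1 -> g t = h t) -> moment p g = moment p h.
Proof.
  intros H. apply RInt_ext. rewrite Rmin_left, Rmax_right by lra.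
  intros s Hs. rewrite H; [reflexivity|nra].
Qed.

Lemma moment_plus (p : nat) (g h : R -> R) :
  (forall t, 0 <= t <= 1 -> continuous g t) ->
  (forall t, 0 <= t <= 1 -> continuous h t) ->
  moment p (fun t => g t + h t) = moment p g + moment p h.
Proof.
  intros Hg Hh. unfold moment.
  rewrite <- (RInt_plus (V := R_CompleteNormedModule)) by now apply ex_RInt_weight.
  apply RInt_ext. intros s _. unfold plus; simpl. ring.
Qed.

Lemma moment_scal (p : nat) (c : R) (g : R -> R) :
  (forall t, 0 <= t <= 1 -> continuous g t) ->
  moment p (fun t => c * g t) = c * moment p g.
Proof.
  intros Hg. unfold moment.
  rewrite <- (RInt_scal (V := R_CompleteNormedModule)) by now apply ex_RInt_weight.
  apply RInt_ext. intros s _. unfold scal; simpl; unfold mult; simpl. ring.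
Qed.

(** In the variable [t = s ^ 2] the density [v_p = (- ln t) ^ p / p!] satisfies
    [t * v_(p+1)' = - v_p], and the left-hand integrand is [v_(p+1)] times the derivative of
    [t * g t].  This one identity yields both the moments of the density and the derivative
    of the polylogarithm. *)
Lemma moment_by_parts (p : nat) (g dg : R -> R) :
  (forall t, 0 <= t <= 1 -> is_derive g t (dg t)) ->
  (forall t, 0 <= t <= 1 -> continuous dg t) ->
  moment (S p) (fun t => g t + t * dg t) = moment p g.
Proof.
  intros Hg Hdg.
  assert (Hgc : forall t, 0 <= t <= 1 -> continuous g t).
  { intros t Ht. apply (ex_derive_continuous g). exists (dg t). now apply Hg. }
  assert (Hsc : forall t, 0 <= t <= 1 -> continuous (fun t => g t + t * dg t) t).
  { intros t Ht. apply (continuous_plus (V := R_NormedModule)); [now apply Hgc|].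
    apply (continuous_mult (fun t => t) dg); [apply continuous_id | now apply Hdg]. }
  pose (F := fun s => (-2 * ln s) ^ S p / INR (fact (S p)) * (s ^ 2 * g (s ^ 2))).
  pose (f := fun s => weight (S p) s * (g (s ^ 2) + s ^ 2 * dg (s ^ 2))
                      - weight p s * g (s ^ 2)).
  assert (HI : RInt f 0 1 = F 1 - F 0).
  { apply RInt_of_antiderivative.
    - intros s Hs. unfold F, f.
      assert (Hd : is_derive (fun s => g (s ^ 2)) s (2 * s * dg (s ^ 2))).
      { replace (2 * s * dg (s ^ 2)) with (scal (2 * s) (dg (s ^ 2))) by reflexivity.
        apply (is_derive_comp g (fun s => s ^ 2)).
        - apply Hg. nra.
        - auto_derive; [exact I | ring]. }
      assert (Hv : is_derive (fun s => (-2 * ln s) ^ S p / INR (fact (S p)) * s ^ 2) s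
                 (weight (S p) s - weight p s)).
      { unfold weight. change (fact (S p)) with (S p * fact p)%nat.
        rewrite mult_INR.
        assert (H1 := INR_fact_neq_0 p). assert (H2 := not_0_INR (S p) ltac:(lia)).
        auto_derive; [lra|]. simpl pred.
        change (match p with O => 1 | S _ => INR p + 1 end) with (INR (S p)).
        change ((-2 * ln s) ^ S p) with ((-2 * ln s) * (-2 * ln s) ^ p).
        field. repeat split; [exact H1 | exact H2 | lra]. }
      apply is_derive_ext with
        (fun s => (-2 * ln s) ^ S p / INR (fact (S p)) * s ^ 2 * g (s ^ 2)).
      + intros t. in_R. ring.
      + replace (weight (S p) s * (g (s ^ 2) + s ^ 2 * dg (s ^ 2)) - weight p s * g (s ^ 2))
          with (plus (mult (weight (S p) s - weight p s) (g (s ^ 2)))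
                  (mult ((-2 * ln s) ^ S p / INR (fact (S p)) * s ^ 2)
                     (2 * s * dg (s ^ 2)))).
        * apply (is_derive_mult (fun s => (-2 * ln s) ^ S p / INR (fact (S p)) * s ^ 2)
                   (fun s => g (s ^ 2))); [exact Hv | exact Hd | intros; apply Rmult_comm].
        * in_R. unfold weight.
          field. split; apply INR_fact_neq_0.
    - apply continuous_ext with (fun s => (-2) ^ S p / INR (fact (S p))
         * (s * ln s ^ S p) * (s * g (s ^ 2))).
      { intros t. unfold F. in_R. rewrite Rpow_mult_distr. field. apply INR_fact_neq_0. }
      apply (continuous_mult (fun s => (-2) ^ S p / INR (fact (S p)) * (s * ln s ^ S p))
               (fun s => s * g (s ^ 2))).
      + apply (continuous_scal_r (V := R_NormedModule) _ (fun s => s * ln s ^ S p)).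
        apply continuous_mul_ln_pow. lra.
      + apply (continuous_mult (fun s => s) (fun s => g (s ^ 2))); [apply continuous_id|].
        apply continuous_sqr_comp; [exact Hgc | lra].
    - intros s Hs. apply (continuous_minus (V := R_NormedModule)).
      + now apply (continuous_weight_mul (S p) (fun t => g t + t * dg t)).
      + now apply continuous_weight_mul. }
  unfold f in HI.
  rewrite (RInt_minus (V := R_CompleteNormedModule)
             (fun s => weight (S p) s * (g (s ^ 2) + s ^ 2 * dg (s ^ 2)))) in HI.
  - change (moment (S p) (fun t => g t + t * dg t) - moment p g = F 1 - F 0) in HI.
    assert (HF1 : F 1 = 0) by (unfold F; rewrite ln_1; simpl; field; apply (INR_fact_neq_0 (S p))).
    assert (HF0 : F 0 = 0) by (unfold F; simpl; ring).
    lra.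
  - now apply (ex_RInt_weight (S p) (fun t => g t + t * dg t)).
  - now apply ex_RInt_weight.
Qed.

Lemma is_derive_pow_id (n : nat) (t : R) : is_derive (fun t => t ^ n) t (INR n * t ^ pred n).
Proof. auto_derive; [exact I | ring]. Qed.

Lemma continuous_pow_id (n : nat) (t : R) : continuous (fun t => t ^ n) t.
Proof. apply (ex_derive_continuous (fun t => t ^ n)). eexists. apply is_derive_pow_id. Qed.

Lemma moment_pow (p n : nat) : moment p (fun t => t ^ n) = / INR (S n) ^ S p.
Proof.
  assert (Hn := not_0_INR (S n) ltac:(lia)).
  induction p as [|p IH].
  - unfold moment.
    assert (HF : forall s, is_derive (fun s => (s ^ 2) ^ S n / INR (S n)) s
                             (weight 0 s * (s ^ 2) ^ n)).
    { intros s.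
      replace (weight 0 s * (s ^ 2) ^ n) with (scal (2 * s) ((s ^ 2) ^ n))
        by (in_R; unfold weight; simpl; field).
      apply (is_derive_comp (fun t => t ^ S n / INR (S n)) (fun s => s ^ 2)).
      - apply is_derive_ext with (fun t => / INR (S n) * t ^ S n);
          [intros t; in_R; field; exact Hn|].
        replace ((s ^ 2) ^ n) with (/ INR (S n) * (INR (S n) * (s ^ 2) ^ pred (S n)))
          by (simpl pred; field; exact Hn).
        apply (is_derive_scal (fun t => t ^ S n)). apply is_derive_pow_id.
      - auto_derive; [exact I | ring]. }
    rewrite (RInt_of_antiderivative (fun s => (s ^ 2) ^ S n / INR (S n))).
    + rewrite !pow1, pow_1, (pow_i 2), (pow_i (S n)) by lia. field. exact Hn.
    + intros s _. apply HF.
    + apply (ex_derive_continuous (fun s => (s ^ 2) ^ S n / INR (S n))).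
      eexists. apply HF.
    + now apply (continuous_weight_mul 0 (fun t => t ^ n)); intros; apply continuous_pow_id.
  - rewrite <- (moment_ext _ (fun t => / INR (S n) * t ^ n
       + t * (/ INR (S n) * (INR n * t ^ pred n)))).
    + rewrite moment_by_parts.
      * rewrite moment_scal, IH by (intros; apply continuous_pow_id).
        rewrite <- (tech_pow_Rmult _ (S p)). rewrite Rinv_mult. reflexivity.
      * intros t _. apply (is_derive_scal (fun t => t ^ n)). apply is_derive_pow_id.
      * intros t _. apply (ex_derive_continuous (fun t => / INR (S n) * (INR n * t ^ pred n))).
        auto_derive. exact I.
    + intros t _. rewrite S_INR. destruct n as [|n]; simpl pred.
      * simpl. field.
      * rewrite <- tech_pow_Rmult. rewrite S_INR in Hn. field. exact Hn.
Qed.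

(** * Moments of complex-valued functions and the geometric kernel *)

(** Continuity is recorded by coordinates because complex integrals are
    formed by coordinates in [Cmoment]. *)
Definition Ccont01 (g : R -> C) : Prop :=
  forall t, 0 <= t <= 1 ->
    continuous (fun t => Re (g t)) t /\ continuous (fun t => Im (g t)) t.

Lemma Ccont01_mult (g h : R -> C) :
  Ccont01 g -> Ccont01 h -> Ccont01 (fun t => g t * h t)%C.
Proof.
  intros Hg Hh t Ht. destruct (Hg t Ht) as [Gr Gi], (Hh t Ht) as [Kr Ki]. split.
  - apply (continuous_minus (V := R_NormedModule));
      apply (continuous_mult (K := R_AbsRing)); assumption.
  - apply (continuous_plus (V := R_NormedModule));
      apply (continuous_mult (K := R_AbsRing)); assumption.
Qed.

Lemma Ccont01_plus (g h : R -> C) :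
  Ccont01 g -> Ccont01 h -> Ccont01 (fun t => g t + h t)%C.
Proof.
  intros Hg Hh t Ht. destruct (Hg t Ht) as [Gr Gi], (Hh t Ht) as [Kr Ki].
  split; apply (continuous_plus (V := R_NormedModule)); assumption.
Qed.

Lemma Ccont01_const (c : C) : Ccont01 (fun _ => c).
Proof. intros t _. split; apply continuous_const. Qed.

Lemma Ccont01_id : Ccont01 (fun t => RtoC t).
Proof. intros t _. split; [apply continuous_id | apply continuous_const]. Qed.

Lemma Ccont01_pow (g : R -> C) (n : nat) : Ccont01 g -> Ccont01 (fun t => g t ^ n)%C.
Proof.
  intros Hg. induction n as [|n IH]; [exact (Ccont01_const 1%C)|].
  now apply (Ccont01_mult g (fun t => g t ^ n)%C).
Qed.

Lemma Ccont01_inv (g : R -> C) :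
  (forall t, 0 <= t <= 1 -> g t <> 0%C) -> Ccont01 g -> Ccont01 (fun t => / g t)%C.
Proof.
  intros Hnz Hg t Ht. destruct (Hg t Ht) as [Gr Gi].
  assert (Hq : (Re (g t)) ^ 2 + (Im (g t)) ^ 2 <> 0).
  { rewrite <- Cmod2_alt. apply pow_nonzero. intros H0.
    apply (Hnz t Ht). now apply Cmod_eq_0. }
  assert (Hi : continuous (fun t => / ((Re (g t)) ^ 2 + (Im (g t)) ^ 2)) t).
  { apply continuous_Rinv_comp; [|exact Hq].
    apply (continuous_plus (V := R_NormedModule)).
    - apply (continuous_comp (fun t => Re (g t)) (fun x => x ^ 2)); [exact Gr|apply continuous_pow_id].
    - apply (continuous_comp (fun t => Im (g t)) (fun x => x ^ 2)); [exact Gi|apply continuous_pow_id]. }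
  split.
  - apply (continuous_mult (K := R_AbsRing)); assumption.
  - apply (continuous_mult (K := R_AbsRing)); [|assumption].
    now apply (continuous_opp (V := R_NormedModule)).
Qed.

Definition Cmoment (p : nat) (g : R -> C) : C :=
  (moment p (fun t => Re (g t)), moment p (fun t => Im (g t))).

Lemma Cmoment_ext (p : nat) (g h : R -> C) :
  (forall t, 0 <= t <= 1 -> g t = h t) -> Cmoment p g = Cmoment p h.
Proof. intros H. unfold Cmoment. f_equal; apply moment_ext; intros t Ht; now rewrite H. Qed.

Lemma Cmoment_plus (p : nat) (g h : R -> C) :
  Ccont01 g -> Ccont01 h ->
  (Cmoment p (fun t => g t + h t) = Cmoment p g + Cmoment p h)%C.
Proof.
  intros Hg Hh. apply injective_projections; simpl;
    [apply (moment_plus p (fun t => Re (g t)) (fun t => Re (h t)))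
    |apply (moment_plus p (fun t => Im (g t)) (fun t => Im (h t)))];
    intros t Ht; (apply (Hg t Ht) || apply (Hh t Ht)).
Qed.

Lemma Cmoment_scal (p : nat) (c : C) (g : R -> C) :
  Ccont01 g -> (Cmoment p (fun t => c * g t) = c * Cmoment p g)%C.
Proof.
  intros Hg.
  assert (Hr : forall t, 0 <= t <= 1 -> continuous (fun t => Re (g t)) t)
    by (intros t Ht; apply (Hg t Ht)).
  assert (Hi : forall t, 0 <= t <= 1 -> continuous (fun t => Im (g t)) t)
    by (intros t Ht; apply (Hg t Ht)).
  assert (Hs : forall (a : R) (u : R -> R), (forall t, 0 <= t <= 1 -> continuous u t) ->
            forall t, 0 <= t <= 1 -> continuous (fun t => a * u t) t).
  { intros a u Hu t Ht. apply (continuous_scal_r (V := R_NormedModule) a u). now apply Hu. }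
  destruct c as [a b]. apply injective_projections.
  - change (moment p (fun t => Re ((a, b) * g t)%C) =
      a * moment p (fun t => Re (g t)) - b * moment p (fun t => Im (g t))).
    rewrite <- (moment_scal p a (fun t : R => Re (g t)) Hr).
    replace (b * moment p (fun t => Im (g t))) with (- (- b * moment p (fun t => Im (g t)))) by ring.
    rewrite <- (moment_scal p (- b) (fun t : R => Im (g t)) Hi). unfold Rminus. rewrite Ropp_involutive.
    rewrite <- moment_plus by (apply Hs; assumption).
    apply moment_ext. intros t _. unfold Re, Im; simpl; ring.
  - change (moment p (fun t => Im ((a, b) * g t)%C) =
      a * moment p (fun t => Im (g t)) + b * moment p (fun t => Re (g t))).
    rewrite <- (moment_scal p a (fun t : R => Im (g t)) Hi), <- (moment_scal p b (fun t : R => Re (g t)) Hr).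
    rewrite <- moment_plus by (apply Hs; assumption).
    apply moment_ext. intros t _. unfold Re, Im; simpl; ring.
Qed.

Lemma Cmoment_RtoC (p : nat) (g : R -> R) : Cmoment p (fun t => RtoC (g t)) = RtoC (moment p g).
Proof.
  unfold Cmoment, RtoC. f_equal. unfold moment. simpl.
  rewrite (RInt_ext _ (fun _ => 0)) by (intros; in_R; ring).
  rewrite RInt_const. in_R. ring.
Qed.

(** The density is nonnegative of total mass one. *)
Lemma Rabs_moment_le (p : nat) (g : R -> R) (M : R) :
  (forall t, 0 <= t <= 1 -> continuous g t) ->
  (forall t, 0 <= t <= 1 -> Rabs (g t) <= M) ->
  Rabs (moment p g) <= M.
Proof.
  intros Hg HM.
  assert (Hmass : moment p (fun _ => 1) = 1).
  { rewrite (moment_ext p _ (fun t => t ^ 0)) by (intros; simpl; ring).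
    rewrite moment_pow. simpl INR. rewrite pow1. field. }
  replace M with (M * moment p (fun _ => 1)) by (rewrite Hmass; ring).
  assert (H1 : forall t, 0 <= t <= 1 -> continuous (fun _ : R => 1) t)
    by (intros; apply continuous_const).
  rewrite <- moment_scal by exact H1.
  apply (norm_RInt_le (V := R_NormedModule) (fun s => weight p s * g (s ^ 2))
           (fun s => weight p s * (M * 1)) 0 1).
  - lra.
  - intros s Hs. change (Rabs (weight p s * g (s ^ 2)) <= weight p s * (M * 1)).
    rewrite Rabs_mult, (Rabs_pos_eq (weight p s)) by now apply weight_ge_0.
    apply Rmult_le_compat_l; [now apply weight_ge_0|].
    rewrite Rmult_1_r. apply HM. nra.
  - apply (RInt_correct (V := R_CompleteNormedModule)). now apply ex_RInt_weight.
  - apply (RInt_correct (V := R_CompleteNormedModule)).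
    apply (ex_RInt_weight p (fun _ => M * 1)). intros; apply continuous_const.
Qed.

Lemma Cmod_Cmoment_le (p : nat) (g : R -> C) (M : R) :
  Ccont01 g -> (forall t, 0 <= t <= 1 -> Cmod (g t) <= M) ->
  Cmod (Cmoment p g) <= sqrt 2 * M.
Proof.
  intros Hg HM. apply Rle_trans with (1 := Cmod_2Rmax _).
  apply Rmult_le_compat_l; [apply sqrt_pos|].
  assert (Hm : forall t, 0 <= t <= 1 -> Rmax (Rabs (Re (g t))) (Rabs (Im (g t))) <= M).
  { intros t Ht. apply Rle_trans with (2 := HM t Ht). apply Rmax_Cmod. }
  apply Rmax_lub; apply Rabs_moment_le; intros t Ht; try apply (Hg t Ht).
  - apply Rle_trans with (2 := Hm t Ht). apply Rmax_l.
  - apply Rle_trans with (2 := Hm t Ht). apply Rmax_r.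
Qed.

Definition kernel (x : C) (t : R) : C := (/ (1 - t * x))%C.

Lemma pow_n_Cpow (x : C) (n : nat) : @pow_n C_AbsRing x n = (x ^ n)%C.
Proof. induction n as [|n IH]; [reflexivity|]. simpl. now rewrite IH. Qed.

Lemma Ccont01_kernel (x : C) :
  (forall t, 0 <= t <= 1 -> (1 - t * x)%C <> 0%C) -> Ccont01 (kernel x).
Proof.
  intros H. apply Ccont01_inv; [exact H|].
  apply (Ccont01_plus (fun _ => 1%C) (fun t => - (t * x))%C); [apply Ccont01_const|].
  intros t Ht. destruct (Ccont01_mult _ _ Ccont01_id (Ccont01_const x) t Ht) as [Hr Hi].
  split; now apply (continuous_opp (V := R_NormedModule)).
Qed.

Definition Cmoment_kernel_coef (p : nat) (x0 : C) (n : nat) : C :=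
  Cmoment p (fun t => t ^ n * kernel x0 t ^ S n)%C.

(** Geometric expansion with remainder: with [K = kernel x0] and [K' = kernel (x0 + h)] one has
    [K' = K + t h K K'], which is iterated and integrated.  Keeping the remainder explicit avoids
    exchanging an infinite sum with the integral. *)
Lemma kernel_expansion (p : nat) (x0 h : C) (N : nat) :
  (forall t, 0 <= t <= 1 -> (1 - t * x0)%C <> 0%C) ->
  (forall t, 0 <= t <= 1 -> (1 - t * (x0 + h))%C <> 0%C) ->
  Cmoment p (kernel (x0 + h)) =
    (@sum_n C_AbelianMonoid
      (fun n => @scal C_AbsRing C_ModuleSpace (@pow_n C_AbsRing h n) (Cmoment_kernel_coef p x0 n)) N
    + Cmoment p (fun t => (t * h * kernel x0 t) ^ S N * kernel (x0 + h) t))%C.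
Proof.
  intros H0 H1.
  assert (K0 := Ccont01_kernel _ H0). assert (K1 := Ccont01_kernel _ H1).
  assert (Kh : forall n, Ccont01 (fun t => (t * h * kernel x0 t) ^ n * kernel (x0 + h) t)%C).
  { intros n. apply (Ccont01_mult (fun t => (t * h * kernel x0 t) ^ n)%C); [|exact K1].
    apply (Ccont01_pow (fun t => t * h * kernel x0 t)%C).
    apply (Ccont01_mult (fun t => t * h)%C); [|exact K0].
    apply Ccont01_mult; [apply Ccont01_id | apply Ccont01_const]. }
  assert (Kc : forall n, Ccont01 (fun t => t ^ n * kernel x0 t ^ S n)%C).
  { intros n. apply (Ccont01_mult (fun t => t ^ n)%C (fun t => kernel x0 t ^ S n)%C).
    - apply (Ccont01_pow RtoC), Ccont01_id.
    - now apply Ccont01_pow. }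
  assert (Hstep : forall n,
    (Cmoment p (fun t => (t * h * kernel x0 t) ^ n * kernel (x0 + h) t) =
     @scal C_AbsRing C_ModuleSpace (@pow_n C_AbsRing h n) (Cmoment_kernel_coef p x0 n) +
     Cmoment p (fun t => (t * h * kernel x0 t) ^ S n * kernel (x0 + h) t))%C).
  { intros n. rewrite pow_n_Cpow. change (@scal C_AbsRing C_ModuleSpace) with Cmult.
    unfold Cmoment_kernel_coef. rewrite <- Cmoment_scal by apply Kc.
    rewrite <- Cmoment_plus; [|apply (Ccont01_mult (fun _ => (h ^ n)%C)); [apply Ccont01_const|apply Kc] | apply Kh].
    apply Cmoment_ext. intros t Ht.
    assert (E : (kernel (x0 + h) t = kernel x0 t + t * h * kernel x0 t * kernel (x0 + h) t)%C).
    { unfold kernel. field. split; [apply H1 | apply H0]; exact Ht. }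
    rewrite E at 1. simpl Cpow. rewrite !Cpow_mult_l. ring. }
  induction N as [|N IH].
  - rewrite sum_O. rewrite <- Hstep. apply Cmoment_ext. intros t _. simpl. ring.
  - rewrite sum_Sn. rewrite IH, (Hstep (S N)). apply Cplus_assoc.
Qed.

(** * Existence of the analytic continuation of the polylogarithm *)

Lemma Cmod_kernel_shift (x0 h : C) (d t : R) :
  0 <= t <= 1 -> d <= Cmod (1 - t * x0)%C -> d - Cmod h <= Cmod (1 - t * (x0 + h))%C.
Proof.
  intros Ht Hd.
  assert (E : (1 - t * x0 = (1 - t * (x0 + h)) + t * h)%C) by ring.
  rewrite E in Hd. assert (T := Cmod_triangle (1 - t * (x0 + h)) (t * h)).
  rewrite Cmod_mult, Cmod_R, Rabs_pos_eq in T by lra.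
  assert (Hh := Cmod_ge_0 h). nra.
Qed.

(** The remainder in [kernel_expansion] is at most a constant times [(Cmod h / d) ^ (N + 1)]. *)
Lemma is_pseries_Cmoment_kernel (p : nat) (x0 h : C) (d : R) :
  (forall t, 0 <= t <= 1 -> d <= Cmod (1 - t * x0)%C) -> Cmod h < d ->
  @is_pseries C_AbsRing C_NormedModule (Cmoment_kernel_coef p x0) h (Cmoment p (kernel (x0 + h))).
Proof.
  intros Hd Hh. assert (Hh0 := Cmod_ge_0 h).
  set (rho := Cmod h / d).
  assert (Hrho : 0 <= rho < 1).
  { unfold rho. split; [apply Rdiv_le_0_compat; lra|].
    apply Rmult_lt_reg_r with d; [lra|]. field_simplify; lra. }
  assert (H0 : forall t, 0 <= t <= 1 -> (1 - t * x0)%C <> 0%C).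
  { intros t Ht E. assert (H := Hd t Ht). rewrite E, Cmod_0 in H. lra. }
  assert (Hd1 := fun t Ht => Cmod_kernel_shift x0 h d t Ht (Hd t Ht)).
  assert (H1 : forall t, 0 <= t <= 1 -> (1 - t * (x0 + h))%C <> 0%C).
  { intros t Ht E. assert (H := Hd1 t Ht). rewrite E, Cmod_0 in H. lra. }
  assert (K0 := Ccont01_kernel _ H0). assert (K1 := Ccont01_kernel _ H1).
  assert (Hrem : forall N,
    Cmod (Cmoment p (fun t => (t * h * kernel x0 t) ^ S N * kernel (x0 + h) t))%C
      <= sqrt 2 * (rho ^ S N * / (d - Cmod h))).
  { intros N. apply Cmod_Cmoment_le.
    - apply (Ccont01_mult (fun t => (t * h * kernel x0 t) ^ S N)%C); [|exact K1].
      apply (Ccont01_pow (fun t => t * h * kernel x0 t)%C).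
      apply (Ccont01_mult (fun t => t * h)%C); [|exact K0].
      apply Ccont01_mult; [apply Ccont01_id | apply Ccont01_const].
    - intros t Ht. rewrite Cmod_mult, Cmod_pow, !Cmod_mult. unfold kernel.
      rewrite !Cmod_inv by (now apply H0 || now apply H1).
      rewrite Cmod_R, Rabs_pos_eq by lra.
      apply Rmult_le_compat.
      + apply pow_le. apply Rmult_le_pos; [apply Rmult_le_pos; lra|].
        apply Rlt_le, Rinv_0_lt_compat. apply Rlt_le_trans with (2 := Hd t Ht). lra.
      + apply Rlt_le, Rinv_0_lt_compat. apply Rlt_le_trans with (2 := Hd1 t Ht). lra.
      + assert (Hi : / Cmod (1 - t * x0)%C <= / d) by (apply Rinv_le_contravar; [lra|now apply Hd]).
        assert (Hi0 : 0 < / Cmod (1 - t * x0)%C).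
        { apply Rinv_0_lt_compat. apply Rlt_le_trans with (2 := Hd t Ht). lra. }
        apply pow_incr. split.
        * apply Rmult_le_pos; [apply Rmult_le_pos; lra | lra].
        * unfold rho, Rdiv. apply Rmult_le_compat; [apply Rmult_le_pos; lra | lra | nra | exact Hi].
      + apply Rinv_le_contravar; [lra | now apply Hd1]. }
  unfold is_pseries, is_series. apply filterlim_locally. intros eps.
  destruct (pow_lt_1_zero rho) with (y := eps * (d - Cmod h) / sqrt 2) as [N HN].
  { rewrite Rabs_pos_eq; lra. }
  { apply Rdiv_lt_0_compat; [|apply Rlt_sqrt2_0].
    apply Rmult_lt_0_compat; [apply cond_pos | lra]. }
  exists N. intros n Hn.
  apply (C_NormedModule_mixin_compat1 (Cmoment p (kernel (x0 + h)))).
  assert (HN' := HN (S n) ltac:(lia)). rewrite Rabs_pos_eq in HN' by (apply pow_le; lra).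
  rewrite (kernel_expansion p x0 h n H0 H1).
  match goal with |- Cmod (minus ?a (?b + ?c)%C) < _ =>
    change (Cmod (a - (a + c))%C < eps); replace (a - (a + c))%C with (- c)%C by ring
  end.
  rewrite Cmod_opp. apply Rle_lt_trans with (1 := Hrem n).
  assert (Hs := Rlt_sqrt2_0).
  apply Rmult_lt_reg_r with ((d - Cmod h) / sqrt 2); [apply Rdiv_lt_0_compat; lra|].
  replace (sqrt 2 * (rho ^ S n * / (d - Cmod h)) * ((d - Cmod h) / sqrt 2)) with (rho ^ S n)
    by (field; lra).
  replace (eps * ((d - Cmod h) / sqrt 2)) with (eps * (d - Cmod h) / sqrt 2) by (field; lra).
  exact HN'.
Qed.

(** [t * x = 1] with [t] in [[0, 1]] would put [x] on the cut, so the polynomial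
    [Cmod (1 - t * x) ^ 2] in [t] has a positive minimum there. *)
Lemma slit_plane_kernel_bound (x : C) :
  slit_plane x -> exists d, 0 < d /\ forall t, 0 <= t <= 1 -> d <= Cmod (1 - t * x)%C.
Proof.
  intros Hx. destruct x as [a b].
  pose (q := fun t => (1 - t * a) ^ 2 + (t * b) ^ 2).
  destruct (continuity_ab_min q 0 1 ltac:(lra)) as [m [Hm Hm1]].
  { intros t _. apply continuity_pt_filterlim, (ex_derive_continuous q).
    unfold q. auto_derive. exact I. }
  assert (Hq : 0 < q m).
  { unfold q. destruct (Req_dec (m * b) 0) as [E|E].
    - enough (0 < (1 - m * a) ^ 2) by (rewrite E; lra).
      apply pow2_gt_0. intros E1. apply Hx. simpl.
      assert (m <> 0) by (intros ->; lra). split; [nra|].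
      assert (m * a = 1) by lra. assert (0 < m) by lra.
      apply Rmult_le_reg_l with m; lra.
    - assert (H1 := pow2_gt_0 _ E). assert (H2 := pow2_ge_0 (1 - m * a)). lra. }
  exists (sqrt (q m)). split; [now apply sqrt_lt_R0|].
  intros t Ht. unfold Cmod. apply sqrt_le_1_alt. simpl fst; simpl snd.
  apply Rle_trans with (1 := Hm t Ht). unfold q. right. ring.
Qed.

Definition polylog (p : nat) (x : C) : C := (x * Cmoment p (kernel x))%C.

(** The prefactor is split as [x = x0 + (x - x0)]. *)
Lemma polylog_analytic (p : nat) (x0 : C) :
  slit_plane x0 ->
  exists r, 0 < r /\ forall x, Cmod (x - x0)%C < r ->
    @is_pseries C_AbsRing C_NormedModule
      (PS_plus (PS_scal x0 (Cmoment_kernel_coef p x0)) (PS_incr_1 (Cmoment_kernel_coef p x0)))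
      (x - x0)%C (polylog p x).
Proof.
  intros Hx. destruct (slit_plane_kernel_bound x0 Hx) as [d [Hd0 Hd]].
  exists d. split; [exact Hd0|]. intros x Hxd.
  assert (H := is_pseries_Cmoment_kernel p x0 (x - x0) d Hd Hxd).
  replace (x0 + (x - x0))%C with x in H by ring.
  unfold polylog.
  replace (x * Cmoment p (kernel x))%C with
    (plus (scal (K := C_AbsRing) (V := C_ModuleSpace) x0 (Cmoment p (kernel x)))
       (scal (K := C_AbsRing) (V := C_ModuleSpace) (x - x0)%C (Cmoment p (kernel x)))).
  - apply (is_pseries_plus (K := C_AbsRing) (V := C_NormedModule)).
    + apply (is_pseries_scal (K := C_AbsRing) (V := C_NormedModule)); [apply Cmult_comm | exact H].
    + apply (is_pseries_incr_1 (K := C_AbsRing) (V := C_NormedModule)). exact H.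
  - change ((x0 * Cmoment p (kernel x) + (x - x0) * Cmoment p (kernel x))%C
            = (x * Cmoment p (kernel x))%C). ring.
Qed.

Lemma Cmoment_kernel_coef_0 (p n : nat) : Cmoment_kernel_coef p 0 n = RtoC (/ INR (S n) ^ S p).
Proof.
  rewrite <- moment_pow, <- Cmoment_RtoC. apply Cmoment_ext. intros t _.
  assert (E : kernel 0 t = RtoC 1).
  { unfold kernel. field. }
  rewrite E, Cpow_1_l, RtoC_pow. ring.
Qed.

Lemma polylog_is_polylog (p : nat) : is_polylog (S p) (polylog p).
Proof.
  split.
  - intros x Hx. destruct (polylog_analytic p x Hx) as [r [Hr H]].
    exists r. eexists. split; [exact Hr | exact H].
  - intros x Hx.
    assert (H : @is_pseries C_AbsRing C_NormedModule (Cmoment_kernel_coef p 0) x (Cmoment p (kernel (0 + x)))).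
    { apply is_pseries_Cmoment_kernel with 1; [|exact Hx].
      intros t _. replace (1 - t * 0)%C with (RtoC 1) by ring. rewrite Cmod_1. lra. }
    rewrite Cplus_0_l in H.
    apply (is_series_scal (K := C_AbsRing) (V := C_NormedModule) x) in H.
    change (scal x (Cmoment p (kernel x))) with (polylog p x) in H.
    refine (is_series_ext _ _ _ _ H). intros n. rewrite Cmoment_kernel_coef_0, pow_n_Cpow.
    match goal with |- _ = ?r => change ((x * (x ^ n * RtoC (/ INR (S n) ^ S p)))%C = r) end.
    assert (Hn := not_0_INR (S n) ltac:(lia)).
    rewrite RtoC_inv by now apply pow_nonzero. rewrite RtoC_pow.
    change (x ^ S n)%C with (x * x ^ n)%C. unfold Cdiv. ring.
Qed.

Lemma Li_is_polylog (p : nat) : is_polylog (S p) (Li (S p)).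
Proof. unfold Li. apply (epsilon_spec _ (is_polylog (S p))). exists (polylog p). apply polylog_is_polylog. Qed.

(** * Uniqueness of the continuation on the real half-line *)

Lemma is_series_Re_Im (a : nat -> C) (l : C) :
  @is_series C_AbsRing C_NormedModule a l ->
  is_series (fun n => Re (a n)) (Re l) /\ is_series (fun n => Im (a n)) (Im l).
Proof.
  intros H.
  assert (HRe : forall n, Re (@sum_n C_AbelianMonoid a n) = sum_n (fun n => Re (a n)) n).
  { induction n as [|n IH]; [now rewrite !sum_O | rewrite !sum_Sn, <- IH; reflexivity]. }
  assert (HIm : forall n, Im (@sum_n C_AbelianMonoid a n) = sum_n (fun n => Im (a n)) n).
  { induction n as [|n IH]; [now rewrite !sum_O | rewrite !sum_Sn, <- IH; reflexivity]. }
  assert (H' := proj1 (filterlim_locally _ _) H).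
  split; apply filterlim_locally; intros eps; generalize (H' eps); apply filter_imp;
    intros n [B1 B2]; [rewrite <- HRe | rewrite <- HIm]; assumption.
Qed.

Lemma is_pseries_Re_Im (a : nat -> C) (t : R) (l : C) :
  @is_pseries C_AbsRing C_NormedModule a (RtoC t) l ->
  is_pseries (fun n => Re (a n)) t (Re l) /\ is_pseries (fun n => Im (a n)) t (Im l).
Proof.
  intros H. destruct (is_series_Re_Im _ _ H) as [H1 H2].
  assert (E : forall n, @scal C_AbsRing C_ModuleSpace (@pow_n C_AbsRing (RtoC t) n) (a n)
                = (RtoC (t ^ n) * a n)%C).
  { intros n. rewrite pow_n_Cpow, RtoC_pow. reflexivity. }
  split; [refine (is_series_ext _ _ _ _ H1) | refine (is_series_ext _ _ _ _ H2)];
    intros n; rewrite pow_n_pow.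
  - transitivity (Re (RtoC (t ^ n) * a n)%C); [f_equal; apply E | apply re_scal_l].
  - transitivity (Im (RtoC (t ^ n) * a n)%C); [f_equal; apply E | apply im_scal_l].
Qed.

Lemma CV_radius_ge_of_is_pseries (a : nat -> R) (x l : R) :
  is_pseries a x l -> Rbar_le (Rabs x) (CV_radius a).
Proof.
  intros H. apply Rbar_not_lt_le. intros Hlt.
  apply (CV_disk_outside a x Hlt).
  apply is_lim_seq_ext with (fun n => scal (pow_n x n) (a n)).
  - intros n. rewrite pow_n_pow. in_R. ring.
  - apply ex_series_lim_0. exists l. exact H.
Qed.

(** One-sided identity theorem.  The constant term is the limit at [0+]; dividing the series by
    [t] shifts the coefficients, whence the induction. *)
Lemma pseries_coef_0 (r : R) : 0 < r -> forall (n : nat) (a : nat -> R),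
  (forall t, 0 < t < r -> is_pseries a t 0) -> a n = 0.
Proof.
  intros Hr.
  assert (H0 : forall a : nat -> R, (forall t, 0 < t < r -> is_pseries a t 0) -> a 0%nat = 0).
  { intros a Ha.
    assert (HC : Rbar_lt (Rabs 0) (CV_radius a)).
    { assert (H := CV_radius_ge_of_is_pseries a (r / 2) 0 (Ha (r / 2) ltac:(lra))).
      apply Rbar_lt_le_trans with (2 := H). simpl. rewrite Rabs_R0, Rabs_pos_eq; lra. }
    assert (Hc := PSeries_continuity a 0 HC). apply continuity_pt_filterlim in Hc.
    assert (L1 := filterlim_at_right_of_continuous _ _ _ Hc (PSeries_0 a)).
    assert (L2 : filterlim (PSeries a) (at_right 0) (locally 0)).
    { apply filterlim_ext_loc with (fun _ => 0); [|apply filterlim_const].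
      generalize (at_right_between 0 r Hr). apply filter_imp. intros t Ht.
      symmetry. apply is_pseries_unique. now apply Ha. }
    exact (filterlim_locally_unique _ _ _ L1 L2). }
  induction n as [|n IH]; intros a Ha; [now apply H0|].
  apply (IH (PS_decr_1 a)). intros t Ht.
  assert (H := is_pseries_decr_1 a t (/ t) 0).
  replace 0 with (scal (/ t) (plus 0 (opp (a 0%nat)))).
  - apply H; [|now apply Ha]. in_R. field. lra.
  - rewrite (H0 a Ha). in_R. ring.
Qed.

Lemma Cpseries_coef_0 (r : R) (a : nat -> C) : 0 < r ->
  (forall t, 0 < t < r -> @is_pseries C_AbsRing C_NormedModule a (RtoC t) (RtoC 0)) ->
  forall n, a n = 0.
Proof.
  intros Hr Ha n. apply injective_projections.
  - apply (pseries_coef_0 r Hr n (fun n => Re (a n))). intros t Ht.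
    exact (proj1 (is_pseries_Re_Im _ _ _ (Ha t Ht))).
  - apply (pseries_coef_0 r Hr n (fun n => Im (a n))). intros t Ht.
    exact (proj2 (is_pseries_Re_Im _ _ _ (Ha t Ht))).
Qed.

Lemma slit_plane_RtoC (y : R) : y < 1 -> slit_plane (RtoC y).
Proof. intros Hy [_ H]. simpl in H. lra. Qed.

(** Equality to the right of a point forces equal Taylor series, hence equality in a full
    neighbourhood, with a radius independent of how far to the right equality was known. *)
Lemma analytic_vanishing_step (f g : C -> C) (x0 : R) :
  analytic_at f x0 -> analytic_at g x0 ->
  exists r, 0 < r /\
   forall s, 0 < s ->
    (forall t, 0 < t < s -> f (RtoC (x0 + t)) = g (RtoC (x0 + t))) ->
    forall x, Rabs x < r -> f (RtoC (x0 + x)) = g (RtoC (x0 + x)).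
Proof.
  intros (r & a & Hr & Ha) (r' & b & Hr' & Hb).
  set (m := Rmin r r'). assert (Hm : 0 < m) by now apply Rmin_pos.
  pose (c := PS_plus a (PS_opp b)).
  assert (Hc : forall x : R, Rabs x < m ->
     @is_pseries C_AbsRing C_NormedModule c (RtoC x) (f (RtoC (x0 + x)) - g (RtoC (x0 + x)))%C).
  { intros x Hx.
    assert (E : (RtoC (x0 + x) - RtoC x0)%C = RtoC x) by (rewrite RtoC_plus; ring).
    assert (Ha' := Ha (RtoC (x0 + x))). assert (Hb' := Hb (RtoC (x0 + x))).
    rewrite E, Cmod_R in Ha', Hb'.
    apply (is_pseries_plus (K := C_AbsRing) (V := C_NormedModule)).
    - apply Ha'. apply Rlt_le_trans with (1 := Hx). apply Rmin_l.
    - apply (is_pseries_opp (K := C_AbsRing) (V := C_NormedModule)).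
      apply Hb'. apply Rlt_le_trans with (1 := Hx). apply Rmin_r. }
  exists m. split; [exact Hm|]. intros s Hs Hfg x Hx.
  assert (Hc0 : forall n, c n = RtoC 0).
  { apply (Cpseries_coef_0 (Rmin m s)); [now apply Rmin_pos|].
    intros t Ht. assert (H1 := Rmin_l m s). assert (H2 := Rmin_r m s).
    assert (H := Hc t ltac:(rewrite Rabs_pos_eq; lra)).
    rewrite Hfg in H by lra. unfold Cminus in H. rewrite Cplus_opp_r in H. exact H. }
  assert (H := Hc x Hx).
  assert (Hz : @is_pseries C_AbsRing C_NormedModule c (RtoC x) (RtoC 0)).
  { refine (is_series_ext (V := C_NormedModule) (fun _ => RtoC 0) _ _ _ _).
    - intros n. rewrite Hc0. change (RtoC 0 = (@pow_n C_AbsRing (RtoC x) n * RtoC 0)%C).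
      now rewrite Cmult_0_r.
    - intros P HP. exists 0%nat. intros n _.
      assert (E : @sum_n C_AbelianMonoid (fun _ => RtoC 0) n = RtoC 0).
      { induction n as [|n IH]; [apply sum_O|].
        rewrite sum_Sn, IH. apply (Cplus_0_l 0). }
      change (P (@sum_n C_AbelianMonoid (fun _ => RtoC 0) n)). rewrite E.
      now apply locally_singleton. }
  apply Ceq_minus.
  apply (filterlim_locally_unique (V := C_NormedModule) _ _ _ H Hz).
Qed.

Lemma is_polylog_unique_disc (m : nat) (f g : C -> C) (x : C) :
  is_polylog m f -> is_polylog m g -> Cmod x < 1 -> f x = g x.
Proof.
  intros [_ Hf] [_ Hg] Hx.
  exact (filterlim_locally_unique (V := C_NormedModule) _ _ _ (Hf x Hx) (Hg x Hx)).
Qed.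

(** Inside the unit disc both functions are the sum of the series.  For [y <= -1], consider the
    supremum of the [s] such that the functions agree on [[- s, 0]]: by
    [analytic_vanishing_step] it cannot be smaller than [- y]. *)
Lemma is_polylog_unique (m : nat) (f g : C -> C) (y : R) :
  is_polylog m f -> is_polylog m g -> y < 1 -> f (RtoC y) = g (RtoC y).
Proof.
  intros Hf Hg Hy.
  destruct (Rlt_le_dec (Rabs y) 1) as [Hd|Hd].
  { apply (is_polylog_unique_disc m); try assumption. now rewrite Cmod_R. }
  assert (Hy1 : y <= -1).
  { destruct (Rle_lt_dec 0 y) as [H|H]; [rewrite Rabs_pos_eq in Hd; lra|].
    rewrite Rabs_left in Hd; lra. }
  clear Hd.
  pose (E := fun s => 0 <= s <= - y /\ forall u, 0 <= u <= s -> f (RtoC (- u)) = g (RtoC (- u))).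
  destruct (completeness E) as [s [Hub Hlub]].
  { exists (- y). intros s Hs. apply Hs. }
  { exists 0. split; [lra|]. intros u Hu. apply (is_polylog_unique_disc m); try assumption.
    rewrite Cmod_R, Rabs_Ropp, Rabs_pos_eq; lra. }
  assert (Hhalf : E (1 / 2)).
  { split; [lra|]. intros u Hu. apply (is_polylog_unique_disc m); try assumption.
    rewrite Cmod_R, Rabs_Ropp, Rabs_pos_eq; lra. }
  assert (Hs1 := Hub _ Hhalf).
  assert (Hs2 : s <= - y) by (apply Hlub; intros v Hv; apply Hv).
  assert (Hbelow : forall u, 0 <= u < s -> f (RtoC (- u)) = g (RtoC (- u))).
  { intros u Hu. apply NNPP. intros Hne.
    enough (s <= u) by lra. apply Hlub. intros v [Hv1 Hv2].
    destruct (Rle_lt_dec v u) as [H|H]; [exact H|]. exfalso. apply Hne, Hv2. lra. }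
  destruct (analytic_vanishing_step f g (- s)) as [r [Hr Hstep]].
  { apply Hf, slit_plane_RtoC. lra. }
  { apply Hg, slit_plane_RtoC. lra. }
  assert (Hext : forall x, Rabs x < r -> f (RtoC (- s + x)) = g (RtoC (- s + x))).
  { apply (Hstep s); [lra|]. intros t Ht. replace (- s + t) with (- (s - t)) by ring.
    apply Hbelow. lra. }
  destruct (Req_dec s (- y)) as [Es|Es].
  - replace y with (- s + 0) by lra. apply Hext. rewrite Rabs_R0. exact Hr.
  - exfalso. set (e := Rmin (r / 2) (- y - s)).
    assert (He : 0 < e) by (apply Rmin_pos; lra).
    assert (He1 : e <= r / 2) by apply Rmin_l. assert (He2 : e <= - y - s) by apply Rmin_r.
    enough (E (s + e)) as HE by (assert (H := Hub _ HE); lra).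
    split; [lra|]. intros u Hu. destruct (Rlt_le_dec u s) as [H|H]; [apply Hbelow; lra|].
    replace (- u) with (- s + (s - u)) by ring. apply Hext.
    rewrite Rabs_left1; lra.
Qed.

(** * The real polylogarithm: derivative, series, and value at one *)

(** The restriction of [polylog p], hence of [Li (S p)], to the real half-line [y < 1]. *)
Definition Rpolylog (p : nat) (y : R) : R := y * moment p (fun t => / (1 - t * y)).

Lemma kernel_denom_pos (y t : R) : y < 1 -> 0 <= t <= 1 -> 0 < 1 - t * y.
Proof. intros. destruct (Rle_lt_dec y 0); nra. Qed.

Lemma kernel_RtoC (y t : R) : y < 1 -> 0 <= t <= 1 -> kernel y t = RtoC (/ (1 - t * y)).
Proof.
  intros Hy Ht. assert (H := kernel_denom_pos y t Hy Ht).
  unfold kernel. now rewrite RtoC_inv, RtoC_minus, RtoC_mult by lra.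
Qed.

Lemma polylog_RtoC (p : nat) (y : R) : y < 1 -> polylog p y = RtoC (Rpolylog p y).
Proof.
  intros Hy. unfold polylog, Rpolylog.
  rewrite RtoC_mult, <- Cmoment_RtoC. f_equal.
  apply Cmoment_ext. intros t Ht. now apply kernel_RtoC.
Qed.

Lemma Li_RtoC (p : nat) (y : R) : y < 1 -> Li (S p) y = RtoC (Rpolylog p y).
Proof.
  intros Hy. rewrite <- polylog_RtoC by exact Hy.
  apply (is_polylog_unique (S p)); [apply Li_is_polylog | apply polylog_is_polylog | exact Hy].
Qed.

Lemma continuous_of_ex_derive (f : R -> R) (x : R) : ex_derive f x -> continuous f x.
Proof. apply (ex_derive_continuous f). Qed.

(** The derivative is the first Taylor coefficient of [polylog p] at [y], which is
    [y * t * K ^ 2 + K] integrated against the density, and this equals [K ^ 2] for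
    [K = 1 / (1 - t * y)]. *)
Lemma is_derive_Rpolylog_moment (p : nat) (y : R) : y < 1 ->
  is_derive (Rpolylog p) y (moment p (fun t => (/ (1 - t * y)) ^ 2)).
Proof.
  intros Hy.
  destruct (polylog_analytic p y (slit_plane_RtoC y Hy)) as [r0 [Hr0 H]].
  (* Shrinking the disc keeps it to the left of the branch point, where [polylog] is real. *)
  set (r := Rmin r0 (1 - y)). assert (Hr : 0 < r) by (apply Rmin_pos; lra).
  assert (Hrl := Rmin_l r0 (1 - y)). assert (Hrr := Rmin_r r0 (1 - y)). fold r in Hrl, Hrr.
  match type of H with forall x, _ -> is_pseries ?c _ _ => set (a := c) in H end.
  assert (Hcoef : forall n, Cmoment_kernel_coef p y n = RtoC (moment p (fun t => t ^ n * (/ (1 - t * y)) ^ S n))).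
  { intros n. rewrite <- Cmoment_RtoC. apply Cmoment_ext. intros t Ht.
    rewrite kernel_RtoC by assumption. now rewrite RtoC_mult, !RtoC_pow. }
  assert (Hreal : forall x, Rabs (x - y) < r -> is_pseries (fun n => Re (a n)) (x - y) (Rpolylog p x)).
  { intros x Hx.
    assert (E : (RtoC x - RtoC y)%C = RtoC (x - y)) by now rewrite RtoC_minus.
    assert (Hx1 : x < 1).
    { apply Rabs_def2 in Hx. lra. }
    assert (Hp := H (RtoC x)). rewrite E, Cmod_R, polylog_RtoC in Hp by exact Hx1.
    exact (proj1 (is_pseries_Re_Im _ _ _ (Hp (Rlt_le_trans _ _ _ Hx Hrl)))). }
  assert (Ha1 : Re (a 1%nat) = moment p (fun t => (/ (1 - t * y)) ^ 2)).
  { transitivity (Re (RtoC y * Cmoment_kernel_coef p y 1 + Cmoment_kernel_coef p y 0)%C); [reflexivity|].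
    assert (Hk : forall n t, 0 <= t <= 1 ->
       continuous (fun t => t ^ n * (/ (1 - t * y)) ^ S n) t).
    { intros n t Ht. assert (Hd := kernel_denom_pos y t Hy Ht).
      apply continuous_of_ex_derive. auto_derive. lra. }
    rewrite !Hcoef, <- RtoC_mult, <- RtoC_plus, re_RtoC.
    rewrite <- moment_scal, <- moment_plus; try apply Hk.
    - apply moment_ext. intros t Ht. assert (Hd := kernel_denom_pos y t Hy Ht).
      field. lra.
    - intros t Ht. apply (continuous_scal_r (V := R_NormedModule) y). now apply Hk. }
  rewrite <- Ha1.
  apply is_derive_ext_loc with (fun x => PSeries (fun n => Re (a n)) (x - y)).
  - exists (mkposreal r Hr). intros x Hx. apply is_pseries_unique. now apply Hreal.
  - assert (HR : Rbar_lt (Rabs (y - y)) (CV_radius (fun n => Re (a n)))).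
    { assert (Hr2 := CV_radius_ge_of_is_pseries _ _ _ (Hreal (y + r / 2)
         ltac:(replace (y + r / 2 - y) with (r / 2) by ring; rewrite Rabs_pos_eq; lra))).
      apply Rbar_lt_le_trans with (2 := Hr2). simpl.
      replace (y - y) with 0 by ring. replace (y + r / 2 - y) with (r / 2) by ring.
      rewrite Rabs_R0, Rabs_pos_eq; lra. }
    assert (HD := is_derive_PSeries _ _ HR).
    replace (Re (a 1%nat)) with (scal 1 (PSeries (PS_derive (fun n => Re (a n))) (y - y))).
    + apply (is_derive_comp (PSeries (fun n => Re (a n))) (fun x => x - y)); [exact HD|].
      auto_derive; [exact I | ring].
    + replace (y - y) with 0 by ring. rewrite PSeries_0. unfold PS_derive. in_R. simpl. ring.
Qed.

(** [1 / (1 - t y) ^ 2] is the [t]-derivative of [t / (1 - t y)]. *)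
Lemma moment_kernel_sqr (p : nat) (y : R) : y < 1 ->
  moment (S p) (fun t => (/ (1 - t * y)) ^ 2) = moment p (fun t => / (1 - t * y)).
Proof.
  intros Hy.
  rewrite <- (moment_by_parts p (fun t => / (1 - t * y)) (fun t => y * (/ (1 - t * y)) ^ 2)).
  - apply moment_ext. intros t Ht. assert (H := kernel_denom_pos y t Hy Ht). field. lra.
  - intros t Ht. assert (H := kernel_denom_pos y t Hy Ht). auto_derive; [lra|]. field. lra.
  - intros t Ht. assert (H := kernel_denom_pos y t Hy Ht).
    apply continuous_of_ex_derive. auto_derive. lra.
Qed.

Lemma is_derive_Rpolylog (p : nat) (y : R) : y < 1 -> y <> 0 ->
  is_derive (Rpolylog (S p)) y (Rpolylog p y / y).
Proof.
  intros Hy H0.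
  replace (Rpolylog p y / y) with (moment p (fun t => / (1 - t * y))).
  - rewrite <- moment_kernel_sqr by exact Hy. now apply is_derive_Rpolylog_moment.
  - unfold Rpolylog. field. exact H0.
Qed.

Lemma Rpolylog_at_0 (p : nat) : Rpolylog p 0 = 0.
Proof. unfold Rpolylog. ring. Qed.

Lemma continuous_Rpolylog (p : nat) (y : R) : y < 1 -> continuous (Rpolylog p) y.
Proof.
  intros Hy. apply continuous_of_ex_derive. eexists. now apply is_derive_Rpolylog_moment.
Qed.

Lemma Rpolylog_0 (y : R) : y < 1 -> Rpolylog 0 y = - ln (1 - y).
Proof.
  intros Hy. unfold Rpolylog.
  assert (Hc : forall t, 0 <= t <= 1 -> continuous (fun t => / (1 - t * y)) t).
  { intros t Ht. assert (H := kernel_denom_pos y t Hy Ht).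
    apply continuous_of_ex_derive. auto_derive. lra. }
  rewrite <- moment_scal by exact Hc. unfold moment.
  assert (HF : forall s, 0 <= s <= 1 -> is_derive (fun s => - ln (1 - s ^ 2 * y)) s
     (weight 0 s * (y * / (1 - s ^ 2 * y)))).
  { intros s Hs. assert (H := kernel_denom_pos y (s ^ 2) Hy ltac:(nra)).
    unfold weight. auto_derive; [simpl in H; lra|]. simpl in *. field. lra. }
  rewrite (RInt_of_antiderivative (fun s => - ln (1 - s ^ 2 * y))).
  - rewrite pow1, pow_i, Rmult_0_l, Rminus_0_r, ln_1, Rmult_1_l by lia. ring.
  - intros s Hs. apply HF. lra.
  - apply continuous_of_ex_derive. eexists. apply HF. lra.
  - apply (continuous_weight_mul 0 (fun t => y * / (1 - t * y))).
    intros t Ht. apply (continuous_scal_r (V := R_NormedModule) y (fun t => / (1 - t * y))).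
    now apply Hc.
Qed.

Lemma is_series_Rpolylog (p : nat) (y : R) : Rabs y < 1 ->
  is_series (fun n => / INR (S n) ^ S p * y ^ S n) (Rpolylog p y).
Proof.
  intros Hy. assert (Hy1 : y < 1) by (apply Rabs_def2 in Hy; lra).
  destruct (polylog_is_polylog p) as [_ H].
  assert (H1 := H (RtoC y)). rewrite Cmod_R in H1. specialize (H1 Hy).
  rewrite polylog_RtoC in H1 by exact Hy1.
  apply is_series_Re_Im in H1. destruct H1 as [H1 _].
  refine (is_series_ext _ _ _ _ H1). intros n.
  assert (Hn := not_0_INR (S n) ltac:(lia)).
  rewrite <- !RtoC_pow, <- RtoC_div by now apply pow_nonzero.
  rewrite re_RtoC. unfold Rdiv. in_R. ring.
Qed.

(** Comparison with the telescoping series of [2 * (1 / (n + 1) - 1 / (n + 2))]; the factor 2 covers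
    [(n + 2) / (n + 1) <= 2]. *)
Lemma ex_series_inv_pow (p : nat) : ex_series (fun n => / INR (S n) ^ S (S p)).
Proof.
  apply (ex_series_le (V := R_CompleteNormedModule))
    with (fun n => 2 * (/ INR (S n) - / INR (S (S n)))).
  - intros n. change (Rabs (/ INR (S n) ^ S (S p)) <= 2 * (/ INR (S n) - / INR (S (S n)))).
    assert (Hn : 1 <= INR (S n)) by (rewrite S_INR; assert (H := pos_INR n); lra).
    rewrite (S_INR (S n)). set (x := INR (S n)) in *.
    assert (Hp : 1 <= x ^ p) by now apply pow_R1_Rle.
    rewrite Rabs_pos_eq by (apply Rlt_le, Rinv_0_lt_compat, pow_lt; lra).
    replace (2 * (/ x - / (x + 1))) with (/ (x * (x + 1) / 2)) by (field; lra).
    apply Rinv_le_contravar; [nra|]. simpl. nra.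
  - exists (2 * 1). apply (is_series_scal (V := R_NormedModule) 2).
    assert (Hs : forall n, sum_n (fun n => / INR (S n) - / INR (S (S n))) n = 1 - / INR (S (S n))).
    { induction n as [|n IH]; [rewrite sum_O; simpl; in_R; lra|].
      rewrite sum_Sn, IH. in_R. ring. }
    apply (is_lim_seq_ext (fun n => 1 - / INR (S (S n))) _ 1 (fun n => eq_sym (Hs n))).
    replace (Finite 1) with (Finite (1 - 0)) by (f_equal; ring).
    apply is_lim_seq_minus'; [apply is_lim_seq_const|].
    apply (proj1 (is_lim_seq_incr_1 (fun n => / INR (S n)) 0)).
    apply (proj1 (is_lim_seq_incr_1 (fun n => / INR n) 0)).
    replace (Finite 0) with (Rbar_inv p_infty) by reflexivity.
    apply is_lim_seq_inv; [apply is_lim_seq_INR | discriminate].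
Qed.

Lemma zeta_nat (k : nat) : zeta (INR k) = Series (fun n => / INR (S n) ^ k).
Proof.
  apply Series_ext. intros n. rewrite Rpower_pow; [reflexivity|].
  apply lt_0_INR. lia.
Qed.

(** For nonnegative coefficients Abel's theorem is a squeeze: [f y] is at most [l] and at least any
    partial sum at [y], which is continuous in [y]. *)
Lemma Abel_limit_of_nonneg (a : nat -> R) (l : R) (f : R -> R) :
  (forall n, 0 <= a n) -> is_series a l ->
  (forall y, 0 < y < 1 -> is_series (fun n => a n * y ^ S n) (f y)) ->
  filterlim f (at_left 1) (locally l).
Proof.
  intros Ha Hl Hf. apply filterlim_locally. intros eps.
  destruct (proj1 (filterlim_locally _ _) Hl (mkposreal (eps / 2) (is_pos_div_2 eps))) as [N HN].
  specialize (HN N (le_n N)).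
  assert (Hc : continuous (fun y => sum_n (fun n => a n * y ^ S n) N) 1).
  { clear. induction N as [|N IH].
    - apply continuous_ext with (fun y => a 0%nat * y ^ 1); [intros; now rewrite sum_O|].
      apply continuous_of_ex_derive. auto_derive. exact I.
    - apply continuous_ext with
        (fun y => plus (sum_n (fun n => a n * y ^ S n) N) (a (S N) * y ^ S (S N)));
        [intros; now rewrite sum_Sn|].
      apply (continuous_plus (V := R_NormedModule)); [exact IH|].
      apply continuous_of_ex_derive. auto_derive. exact I. }
  assert (Hc' := proj1 (filterlim_locally _ _) Hc (mkposreal (eps / 2) (is_pos_div_2 eps))).
  assert (Hleft : at_left 1 (fun y => 0 < y < 1)).
  { exists (mkposreal 1 Rlt_0_1). intros y Hy Hy1. split; [|exact Hy1].
    apply Rabs_def2 in Hy. unfold minus, plus, opp in Hy; simpl in Hy. lra. }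
  assert (Hle := filter_and _ _ (filter_le_within _ _ Hc') Hleft).
  revert Hle. apply filter_imp. intros y [Hy1 Hy]. specialize (Hf y Hy).
  set (P := sum_n (fun n => a n * y ^ S n) N : R) in *.
  change (Rabs (P - sum_n (fun n => a n * 1 ^ S n) N) < eps / 2) in Hy1.
  change (Rabs (sum_n a N - l) < eps / 2) in HN.
  assert (E1 : sum_n (fun n => a n * 1 ^ S n) N = sum_n a N).
  { apply sum_n_ext. intros n. rewrite pow1. in_R. ring. }
  rewrite E1 in Hy1. apply Rabs_def2 in Hy1. apply Rabs_def2 in HN.
  assert (Hyp : forall n, 0 <= y ^ S n <= 1).
  { intros n. split; [apply pow_le; lra|]. rewrite <- (pow1 (S n)). apply pow_incr. lra. }
  assert (Hup : f y <= l).
  { rewrite <- (is_series_unique _ _ Hl), <- (is_series_unique _ _ Hf).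
    apply Series_le; [|now exists l]. intros n. specialize (Ha n). specialize (Hyp n).
    split; [apply Rmult_le_pos; lra | nra]. }
  assert (Hlow : P <= f y).
  { unfold P. rewrite <- (is_series_unique _ _ Hf).
    rewrite sum_n_Reals. apply sum_incr. 2: intros n; specialize (Ha n); specialize (Hyp n); nra.
    apply is_series_Reals in Hf. rewrite (is_series_unique _ _ ltac:(apply is_series_Reals; exact Hf)).
    exact Hf. }
  change (Rabs (f y - l) < eps). apply Rabs_def1; lra.
Qed.

Lemma Rpolylog_lim_1 (p : nat) :
  filterlim (Rpolylog (S p)) (at_left 1) (locally (zeta (INR (S (S p))))).
Proof.
  apply Abel_limit_of_nonneg with (fun n => / INR (S n) ^ S (S p)).
  - intros n. apply Rlt_le, Rinv_0_lt_compat, pow_lt, lt_0_INR. lia.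
  - rewrite zeta_nat. apply Series_correct, ex_series_inv_pow.
  - intros y Hy. apply is_series_Rpolylog. rewrite Rabs_pos_eq; lra.
Qed.

(** * Iterated integration by parts of log-sinh integrals *)

Lemma is_RInt_gen_at_right_0 (F f : R -> R) (z l : R) :
  0 < z ->
  (forall t, 0 < t -> is_derive F t (f t)) ->
  (forall t, 0 < t -> continuous f t) ->
  filterlim F (at_right 0) (locally l) ->
  is_RInt_gen f (at_right 0) (at_point z) (F z - l).
Proof.
  intros Hz HF Hf Hl.
  assert (Hdom : filter_prod (at_right 0) (at_point z)
     (fun ab => forall x, Rmin (fst ab) (snd ab) <= x <= Rmax (fst ab) (snd ab) -> 0 < x)).
  { exists (fun t => 0 < t < z) (fun t => t = z); [now apply at_right_between | reflexivity|].
    intros a b Ha -> x. simpl. rewrite Rmin_left, Rmax_right by lra. lra. }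
  assert (HD : forall t, 0 < t -> Derive F t = f t) by (intros; now apply is_derive_unique, HF).
  apply is_RInt_gen_ext with (Derive F).
  - revert Hdom. apply filter_imp. intros ab H x Hx. apply HD, H. split; apply Rlt_le; apply Hx.
  - apply is_RInt_gen_Derive.
    + revert Hdom. apply filter_imp. intros ab H x Hx. eexists. apply HF. now apply H.
    + revert Hdom. apply filter_imp. intros ab H x Hx.
      assert (H0 := H x Hx). apply continuous_ext_loc with f; [|now apply Hf].
      exists (mkposreal x H0). intros y Hy. symmetry. apply HD.
      apply Rabs_def2 in Hy. unfold minus, plus, opp in Hy; simpl in Hy. lra.
    + exact Hl.
    + intros P HP. apply locally_singleton in HP. exact HP.
Qed.

Lemma sinh_pos (t : R) : 0 < t -> 0 < sinh t.
Proof. intros Ht. rewrite <- sinh_0. now apply sinh_lt. Qed.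

Lemma le_sinh (t : R) : 0 <= t -> t <= sinh t.
Proof.
  intros Ht.
  assert (H : forall x, 0 <= x -> 1 <= cosh x).
  { intros x Hx. unfold cosh. rewrite exp_Ropp.
    assert (He := exp_pos x).
    assert (E : exp x + / exp x - 2 = (exp x - 1) ^ 2 * / exp x) by (field; lra).
    assert (0 <= (exp x - 1) ^ 2 * / exp x).
    { apply Rmult_le_pos; [apply pow2_ge_0|]. apply Rlt_le, Rinv_0_lt_compat, He. }
    lra. }
  destruct (MVT_gen (fun x => sinh x - x) 0 t (fun x => cosh x - 1)) as [c [Hc E]].
  - intros x _. auto_derive; [exact I | ring].
  - intros x _. apply continuity_pt_filterlim.
    apply (continuous_of_ex_derive (fun x => sinh x - x)). auto_derive. exact I.
  - rewrite Rmin_left, Rmax_right in Hc by lra. rewrite sinh_0 in E.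
    assert (H1 := H c ltac:(lra)). nra.
Qed.

Lemma coth_mul_le (t : R) : 0 < t < 1 -> cosh t / sinh t * t <= exp 1.
Proof.
  intros Ht. assert (Hs := sinh_pos t ltac:(lra)). assert (Hl := le_sinh t ltac:(lra)).
  assert (Hc : 0 < cosh t <= exp 1).
  { unfold cosh. assert (H1 := exp_pos t). assert (H2 := exp_pos (- t)).
    assert (H3 := exp_increasing _ _ (proj2 Ht)).
    assert (H4 : exp (- t) < exp t) by (apply exp_increasing; lra). lra. }
  replace (cosh t / sinh t * t) with (cosh t * (t / sinh t)) by (field; lra).
  assert (t / sinh t <= 1).
  { apply Rmult_le_reg_r with (sinh t); [exact Hs|]. field_simplify; lra. }
  assert (0 < t / sinh t) by (apply Rdiv_lt_0_compat; lra).
  nra.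
Qed.

(** The growth condition [O(t)] at the origin that kills the boundary terms: it beats every power of
    the logarithm. *)
Definition linear_bound (e : R -> R) : Prop :=
  exists K, 0 <= K /\ forall t, 0 < t < 1 -> Rabs (e t) <= K * t.

(** [coth t] is of order [1 / t], so the derivative of [E] is bounded near [0]; the mean value
    theorem on [[x, t]], with [x] tending to [0], does the rest. *)
Lemma linear_bound_coth_primitive (e E : R -> R) :
  linear_bound e ->
  (forall t, 0 < t -> is_derive E t (cosh t / sinh t * e t)) ->
  filterlim E (at_right 0) (locally 0) ->
  linear_bound E.
Proof.
  intros [K [HK0 HK]] HE Hlim. exists (exp 1 * K).
  assert (He1 := exp_pos 1). split; [nra|].
  intros t Ht. apply le_epsilon. intros eps Heps.
  assert (H := proj1 (filterlim_locally _ _) Hlim (mkposreal eps Heps)).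
  destruct (filter_ex _ (filter_and _ _ H (at_right_between 0 t (proj1 Ht)))) as [x [Hx Hxt]].
  change (Rabs (E x - 0) < eps) in Hx. rewrite Rminus_0_r in Hx.
  destruct (MVT_gen E x t (fun t => cosh t / sinh t * e t)) as [c [Hc Ec]];
    rewrite ?Rmin_left, ?Rmax_right in * by lra.
  - intros s Hs. apply HE. lra.
  - intros s Hs. apply continuity_pt_filterlim.
    apply (continuous_of_ex_derive E). eexists. apply HE. lra.
  - assert (Hd : Rabs (cosh c / sinh c * e c) <= exp 1 * K).
    { assert (Hc1 := coth_mul_le c ltac:(lra)). assert (Hc2 := HK c ltac:(lra)).
      assert (H0 : 0 < cosh c / sinh c).
      { apply Rdiv_lt_0_compat; [|apply sinh_pos; lra].
        unfold cosh. assert (H1 := exp_pos c). assert (H2 := exp_pos (- c)). lra. }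
      rewrite Rabs_mult, (Rabs_pos_eq (cosh c / sinh c)) by lra.
      apply Rle_trans with (cosh c / sinh c * (K * c)).
      - apply Rmult_le_compat_l; lra.
      - replace (cosh c / sinh c * (K * c)) with (cosh c / sinh c * c * K) by ring.
        apply Rmult_le_compat_r; lra. }
    replace (E t) with (cosh c / sinh c * e c * (t - x) + E x) by lra.
    apply Rle_trans with (1 := Rabs_triang _ _).
    apply Rplus_le_compat; [|lra].
    rewrite Rabs_mult, (Rabs_pos_eq (t - x)) by lra.
    apply Rmult_le_compat; [apply Rabs_pos | lra | exact Hd | lra].
Qed.

(** In terms of [s = sinh t / sinh z] the bound becomes a multiple of [s * ln s ^ q]. *)
Lemma filterlim_linear_bound_mul_log (e : R -> R) (z : R) (q : nat) :
  0 < z -> linear_bound e ->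
  filterlim (fun t => e t * ln (sinh t / sinh z) ^ q) (at_right 0) (locally 0).
Proof.
  intros Hz [K [HK0 HK]]. assert (Hs := sinh_pos z Hz).
  set (F := fun s => s * ln s ^ q).
  apply (filterlim_0_of_abs_le _ _ _ (fun t => K * sinh z * Rabs (F (sinh t / sinh z)))).
  - generalize (at_right_between 0 1 Rlt_0_1). apply filter_imp. intros t Ht.
    assert (Hst := sinh_pos t (proj1 Ht)).
    assert (Hl := le_sinh t ltac:(lra)).
    unfold F. rewrite !Rabs_mult, (Rabs_pos_eq (sinh t / sinh z)) by (apply Rdiv_le_0_compat; lra).
    replace (K * sinh z * (sinh t / sinh z * Rabs (ln (sinh t / sinh z) ^ q)))
      with (K * sinh t * Rabs (ln (sinh t / sinh z) ^ q)) by (field; lra).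
    apply Rmult_le_compat_r; [apply Rabs_pos|].
    apply Rle_trans with (1 := HK t Ht). nra.
  - assert (H1 : filterlim (fun t => sinh t / sinh z) (at_right 0) (at_right 0)).
    { intros P [d Hd]. change (at_right 0 (fun t => P (sinh t / sinh z))).
      assert (Hc : filterlim (fun t => sinh t / sinh z) (at_right 0) (locally 0)).
      { apply filterlim_at_right_of_continuous.
        - apply continuous_of_ex_derive. auto_derive. exact I.
        - rewrite sinh_0. field. lra. }
      assert (H := proj1 (filterlim_locally _ _) Hc d).
      generalize (filter_and _ _ H (at_right_between 0 1 Rlt_0_1)).
      apply filter_imp. intros t [Hb Ht]. apply Hd; [exact Hb|].
      apply Rdiv_lt_0_compat; [now apply sinh_pos | exact Hs]. }
    assert (H2 := filterlim_comp _ _ _ _ _ _ _ _ H1 (filterlim_mul_ln_pow q)).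
    assert (H3 := filterlim_comp _ _ _ _ Rabs _ _ _ H2 (continuous_Rabs 0)).
    rewrite Rabs_R0 in H3.
    assert (H4 := filterlim_comp _ _ _ _ (fun x => K * sinh z * x) _ _ (locally 0) H3).
    apply H4.
    assert (Hc : continuous (fun x => K * sinh z * x) 0)
      by (apply continuous_of_ex_derive; auto_derive; exact I).
    unfold continuous in Hc. rewrite Rmult_0_r in Hc. exact Hc.
Qed.

Lemma is_derive_log_sinh_ratio (z t : R) : 0 < z -> 0 < t ->
  is_derive (fun t => ln (sinh t / sinh z)) t (cosh t / sinh t).
Proof.
  intros Hz Ht. assert (H1 := sinh_pos z Hz). assert (H2 := sinh_pos t Ht).
  auto_derive; [apply Rdiv_lt_0_compat; assumption|]. field. lra.
Qed.

(** [n]-fold integration by parts.  The induction is on the power of the logarithm, for all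
    starting indices [j] at once: the derivative of [e j * u ^ (p + 1)] is
    [d j * u ^ (p + 1) + (p + 1) * d (S j) * u ^ p], where [d j] is the derivative of [e j]. *)
Lemma log_sinh_integral (e : nat -> R -> R) (g : R -> R) (n : nat) (z : R) :
  0 < z ->
  (forall t, 0 < t -> is_derive (e 0%nat) t (g t)) ->
  (forall t, 0 < t -> continuous g t) ->
  (forall j t, (j < n)%nat -> 0 < t -> is_derive (e (S j)) t (cosh t / sinh t * e j t)) ->
  linear_bound (e 0%nat) ->
  (forall j, (j < n)%nat -> filterlim (e (S j)) (at_right 0) (locally 0)) ->
  is_RInt_gen (fun t => g t * ln (sinh t / sinh z) ^ n) (at_right 0) (at_point z)
    ((-1) ^ n * INR (fact n) * e n z).
Proof.
  intros Hz Hg Hgc He Hb0 Hlim.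
  pose (u := fun t => ln (sinh t / sinh z)).
  (* [d j] is the derivative of [e j], by [Hed] below. *)
  pose (d := fun j => match j with O => g | S j => fun t => cosh t / sinh t * e j t end).
  assert (Hu : forall t, 0 < t -> is_derive u t (cosh t / sinh t))
    by (intros; now apply is_derive_log_sinh_ratio).
  assert (Hed : forall j t, (j <= n)%nat -> 0 < t -> is_derive (e j) t (d j t)).
  { intros [|j] t Hj Ht; [now apply Hg | apply He; [lia | exact Ht]]. }
  assert (Hec : forall j t, (j <= n)%nat -> 0 < t -> continuous (e j) t).
  { intros j t Hj Ht. apply continuous_of_ex_derive. eexists. now apply Hed. }
  assert (Hcoth : forall t, 0 < t -> continuous (fun t => cosh t / sinh t) t).
  { intros t Ht. apply continuous_of_ex_derive. assert (H := sinh_pos t Ht). auto_derive. lra. }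
  assert (Huc : forall q t, 0 < t -> continuous (fun t => u t ^ q) t).
  { intros q t Ht. apply (continuous_comp u (fun x => x ^ q)); [|apply continuous_pow_id].
    apply continuous_of_ex_derive. eexists. now apply Hu. }
  assert (Hdc : forall j t, (j <= n)%nat -> 0 < t -> continuous (d j) t).
  { intros [|j] t Hj Ht; [now apply Hgc|].
    apply (continuous_mult (fun t => cosh t / sinh t) (e j)); [now apply Hcoth | apply Hec; [lia|exact Ht]]. }
  assert (Hbound : forall j, (j <= n)%nat -> linear_bound (e j)).
  { induction j as [|j IH]; intros Hj; [exact Hb0|].
    apply (linear_bound_coth_primitive (e j)).
    - apply IH. lia.
    - intros t Ht. apply He; [lia | exact Ht].
    - apply Hlim. lia. }
  assert (Hlim' : forall j q, (j <= n)%nat ->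
     filterlim (fun t => e j t * u t ^ q) (at_right 0) (locally 0)).
  { intros j q Hj. apply filterlim_linear_bound_mul_log; [exact Hz | now apply Hbound]. }
  assert (Huz : u z = 0).
  { unfold u. assert (H := sinh_pos z Hz). replace (sinh z / sinh z) with 1 by (field; lra).
    apply ln_1. }
  assert (Hmain : forall p j, (j + p <= n)%nat ->
     is_RInt_gen (fun t => d j t * u t ^ p) (at_right 0) (at_point z)
       ((-1) ^ p * INR (fact p) * e (j + p)%nat z)).
  { induction p as [|p IH]; intros j Hj.
    - replace ((-1) ^ 0 * INR (fact 0) * e (j + 0)%nat z) with (e j z * u z ^ 0 - 0)
        by (rewrite Nat.add_0_r; simpl; ring).
      apply (is_RInt_gen_at_right_0 (fun t => e j t * u t ^ 0)); [exact Hz | | | apply Hlim'; lia].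
      + intros t Ht. apply is_derive_ext with (e j); [intros; simpl; in_R; ring|].
        replace (d j t * u t ^ 0) with (d j t) by (simpl; ring).
        apply Hed; [lia | exact Ht].
      + intros t Ht. apply (continuous_mult (d j) (fun t => u t ^ 0));
          [apply Hdc; [lia | exact Ht] | now apply Huc].
    - pose (D := fun t => d j t * u t ^ S p + INR (S p) * (d (S j) t * u t ^ p)).
      assert (HI : is_RInt_gen D (at_right 0) (at_point z) (e j z * u z ^ S p - 0)).
      { apply (is_RInt_gen_at_right_0 (fun t => e j t * u t ^ S p)); [exact Hz | | | apply Hlim'; lia].
        - intros t Ht. unfold D.
          replace (d j t * u t ^ S p + INR (S p) * (d (S j) t * u t ^ p))
            with (plus (mult (d j t) (u t ^ S p))
                    (mult (e j t) (INR (S p) * (cosh t / sinh t) * u t ^ pred (S p))))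
            by (in_R; unfold d at 3; simpl pred; ring).
          apply (is_derive_mult (e j) (fun t => u t ^ S p)).
          + apply Hed; [lia | exact Ht].
          + apply (is_derive_pow u). now apply Hu.
          + intros; apply Rmult_comm.
        - intros t Ht. apply (continuous_plus (V := R_NormedModule)).
          + apply (continuous_mult (d j) (fun t => u t ^ S p));
              [apply Hdc; [lia | exact Ht] | now apply Huc].
          + apply (continuous_scal_r (V := R_NormedModule) (INR (S p))
                (fun t => d (S j) t * u t ^ p)).
            apply (continuous_mult (d (S j)) (fun t => u t ^ p));
              [apply Hdc; [lia | exact Ht] | now apply Huc]. }
      assert (HS := is_RInt_gen_scal (V := R_NormedModule) (Fa := at_right 0) (Fb := at_point z) _ (INR (S p)) _ (IH (S j) ltac:(lia))).
      assert (HM := is_RInt_gen_minus (V := R_NormedModule) (Fa := at_right 0) (Fb := at_point z) _ _ _ _ HI HS).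
      replace ((-1) ^ S p * INR (fact (S p)) * e (j + S p)%nat z)
        with (minus (e j z * u z ^ S p - 0)
                (scal (INR (S p)) ((-1) ^ p * INR (fact p) * e (S j + p)%nat z))).
      + revert HM. apply is_RInt_gen_ext. apply filter_forall. intros ab x _.
        unfold D. in_R. ring.
      + in_R. rewrite Huz, (pow_i (S p)) by lia.
        change (fact (S p)) with (S p * fact p)%nat. rewrite mult_INR.
        replace (S j + p)%nat with (j + S p)%nat by lia. simpl pow. ring. }
  exact (Hmain n 0%nat (le_n n)).
Qed.

Lemma lsh_eq (e : nat -> R -> R) (m k : nat) (z : R) : 0 < z ->
  (forall t, e 0%nat t = t ^ S k / INR (S k)) ->
  (forall j t, (j < m - 1 - k)%nat -> 0 < t -> is_derive (e (S j)) t (cosh t / sinh t * e j t)) ->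
  (forall j, (j < m - 1 - k)%nat -> filterlim (e (S j)) (at_right 0) (locally 0)) ->
  lsh m k z = - ((-1) ^ (m - 1 - k) * INR (fact (m - 1 - k)) * e (m - 1 - k)%nat z).
Proof.
  intros Hz He0 He Hlim. unfold lsh. f_equal.
  assert (Hk := not_0_INR (S k) ltac:(lia)).
  apply is_RInt_gen_unique.
  apply log_sinh_integral; try assumption.
  - intros t Ht. apply is_derive_ext with (fun t => / INR (S k) * t ^ S k).
    { intros s. rewrite He0. in_R. field. exact Hk. }
    replace (t ^ k) with (/ INR (S k) * (INR (S k) * t ^ pred (S k)))
      by (simpl pred; field; exact Hk).
    apply (is_derive_scal (fun t => t ^ S k)). apply is_derive_pow_id.
  - intros t Ht. apply continuous_pow_id.
  - exists 1. split; [lra|]. intros t Ht. rewrite He0.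
    assert (Hk1 : 1 <= INR (S k)) by (rewrite S_INR; assert (H := pos_INR k); lra).
    assert (Htk : 0 <= t ^ k <= 1).
    { split; [apply pow_le; lra|]. rewrite <- (pow1 k). apply pow_incr. lra. }
    rewrite Rabs_pos_eq.
    + apply Rmult_le_reg_r with (INR (S k)); [lra|].
      replace (t ^ S k / INR (S k) * INR (S k)) with (t * t ^ k) by (simpl pow; field; exact Hk).
      apply Rle_trans with (t * 1); [apply Rmult_le_compat_l; lra | nra].
    + apply Rdiv_le_0_compat; [apply pow_le|]; lra.
Qed.

(** * Functional equations of the dilogarithm and the trilogarithm *)

Definition Li_1mexp (p : nat) (z : R) : R := Rpolylog p (1 - exp (2 * z)).
Definition Li_1mexpN (p : nat) (z : R) : R := Rpolylog p (1 - exp (-2 * z)).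
Definition Li_expN (p : nat) (z : R) : R := Rpolylog p (exp (-2 * z)).
Definition log2sinh (z : R) : R := ln (2 * sinh z).

Lemma exp_facts (z : R) : 0 < z ->
  1 < exp z /\ exp (2 * z) = exp z * exp z /\ exp (-2 * z) = / (exp z * exp z) /\
  sinh z = (exp z - / exp z) / 2 /\ cosh z = (exp z + / exp z) / 2.
Proof.
  intros Hz. assert (H1 : 1 < exp z) by (rewrite <- exp_0; now apply exp_increasing).
  assert (H2 : exp (2 * z) = exp z * exp z) by (rewrite <- exp_plus; f_equal; ring).
  repeat split.
  - exact H1.
  - exact H2.
  - rewrite <- H2, <- exp_Ropp. f_equal. ring.
  - unfold sinh. now rewrite exp_Ropp.
  - unfold cosh. now rewrite exp_Ropp.
Qed.

Lemma exp_bounds (z : R) : 0 < z -> 1 < exp (2 * z) /\ 0 < exp (-2 * z) < 1.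
Proof.
  intros Hz. repeat split.
  - rewrite <- exp_0. apply exp_increasing. lra.
  - apply exp_pos.
  - rewrite <- exp_0. apply exp_increasing. lra.
Qed.

Lemma is_derive_Li_1mexp (p : nat) (z : R) : 0 < z ->
  is_derive (Li_1mexp (S p)) z (Li_1mexp p z * (cosh z / sinh z + 1)).
Proof.
  intros Hz. destruct (exp_facts z Hz) as (H1 & E2 & _ & Es & Ec).
  destruct (exp_bounds z Hz) as [Hb _].
  replace (Li_1mexp p z * (cosh z / sinh z + 1)) with
    (scal (- 2 * exp (2 * z)) (Rpolylog p (1 - exp (2 * z)) / (1 - exp (2 * z)))).
  - apply (is_derive_comp (Rpolylog (S p)) (fun z => 1 - exp (2 * z))).
    + apply is_derive_Rpolylog; lra.
    + auto_derive; [exact I | ring].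
  - in_R. fold (Li_1mexp p z). rewrite Es, Ec, E2. field.
    repeat split; try lra; nra.
Qed.

Lemma is_derive_Li_1mexpN (p : nat) (z : R) : 0 < z ->
  is_derive (Li_1mexpN (S p)) z (Li_1mexpN p z * (cosh z / sinh z - 1)).
Proof.
  intros Hz. destruct (exp_facts z Hz) as (H1 & _ & E2 & Es & Ec).
  destruct (exp_bounds z Hz) as [_ Hb].
  replace (Li_1mexpN p z * (cosh z / sinh z - 1)) with
    (scal (2 * exp (-2 * z)) (Rpolylog p (1 - exp (-2 * z)) / (1 - exp (-2 * z)))).
  - apply (is_derive_comp (Rpolylog (S p)) (fun z => 1 - exp (-2 * z))).
    + apply is_derive_Rpolylog; lra.
    + auto_derive; [exact I | ring].
  - in_R. fold (Li_1mexpN p z). rewrite Es, Ec, E2. field.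
    repeat split; try lra; nra.
Qed.

Lemma is_derive_Li_expN (p : nat) (z : R) : 0 < z ->
  is_derive (Li_expN (S p)) z (-2 * Li_expN p z).
Proof.
  intros Hz. destruct (exp_bounds z Hz) as [_ Hb].
  replace (-2 * Li_expN p z) with
    (scal (-2 * exp (-2 * z)) (Rpolylog p (exp (-2 * z)) / exp (-2 * z))).
  - apply (is_derive_comp (Rpolylog (S p)) (fun z => exp (-2 * z))).
    + apply is_derive_Rpolylog; lra.
    + auto_derive; [exact I | ring].
  - in_R. fold (Li_expN p z). field. lra.
Qed.

Lemma is_derive_log2sinh (z : R) : 0 < z -> is_derive log2sinh z (cosh z / sinh z).
Proof.
  intros Hz. assert (Hs := sinh_pos z Hz). unfold log2sinh. auto_derive; [lra|]. field. lra.
Qed.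

Lemma Li_1mexp_0 (z : R) : 0 < z -> Li_1mexp 0 z = -2 * z.
Proof.
  intros Hz. destruct (exp_bounds z Hz) as [Hb _]. unfold Li_1mexp.
  rewrite Rpolylog_0 by lra. replace (1 - (1 - exp (2 * z))) with (exp (2 * z)) by ring.
  rewrite ln_exp. ring.
Qed.

Lemma Li_1mexpN_0 (z : R) : 0 < z -> Li_1mexpN 0 z = 2 * z.
Proof.
  intros Hz. destruct (exp_bounds z Hz) as [_ Hb]. unfold Li_1mexpN.
  rewrite Rpolylog_0 by lra. replace (1 - (1 - exp (-2 * z))) with (exp (-2 * z)) by ring.
  rewrite ln_exp. ring.
Qed.

Lemma Li_expN_0 (z : R) : 0 < z -> Li_expN 0 z = z - log2sinh z.
Proof.
  intros Hz. destruct (exp_bounds z Hz) as [_ Hb]. unfold Li_expN, log2sinh.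
  destruct (exp_facts z Hz) as (H1 & _ & E2 & Es & _).
  rewrite Rpolylog_0 by lra.
  replace (2 * sinh z) with (exp z * (1 - exp (-2 * z))) by (rewrite Es, E2; field; lra).
  rewrite ln_mult by lra. rewrite ln_exp. ring.
Qed.

Lemma lim_Li_1mexp (p : nat) : filterlim (Li_1mexp p) (at_right 0) (locally 0).
Proof.
  apply filterlim_at_right_of_continuous.
  - apply (continuous_comp (fun z => 1 - exp (2 * z)) (Rpolylog p)).
    + apply continuous_of_ex_derive. auto_derive. exact I.
    + apply continuous_Rpolylog. rewrite Rmult_0_r, exp_0. lra.
  - unfold Li_1mexp. rewrite Rmult_0_r, exp_0, Rminus_diag. apply Rpolylog_at_0.
Qed.

Lemma lim_Li_1mexpN (p : nat) : filterlim (Li_1mexpN p) (at_right 0) (locally 0).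
Proof.
  apply filterlim_at_right_of_continuous.
  - apply (continuous_comp (fun z => 1 - exp (-2 * z)) (Rpolylog p)).
    + apply continuous_of_ex_derive. auto_derive. exact I.
    + apply continuous_Rpolylog. rewrite Rmult_0_r, exp_0. lra.
  - unfold Li_1mexpN. rewrite Rmult_0_r, exp_0, Rminus_diag. apply Rpolylog_at_0.
Qed.

Lemma lim_Li_expN (p : nat) :
  filterlim (Li_expN (S p)) (at_right 0) (locally (zeta (INR (S (S p))))).
Proof.
  apply (filterlim_comp _ _ _ (fun z => exp (-2 * z)) (Rpolylog (S p)) _ (at_left 1));
    [|apply Rpolylog_lim_1].
  intros P [d Hd]. change (at_right 0 (fun z => P (exp (-2 * z)))).
  assert (Hc : filterlim (fun z => exp (-2 * z)) (at_right 0) (locally 1)).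
  { apply filterlim_at_right_of_continuous.
    - apply continuous_of_ex_derive. auto_derive. exact I.
    - rewrite Rmult_0_r. apply exp_0. }
  assert (H := proj1 (filterlim_locally _ _) Hc d).
  generalize (filter_and _ _ H (at_right_between 0 1 Rlt_0_1)).
  apply filter_imp. intros z [Hb Hz]. apply Hd; [exact Hb|].
  apply exp_bounds. lra.
Qed.

(** [2 sinh z] is written as [sinh z / sinh c] with [sinh c = 1 / 2], to reuse
    [filterlim_linear_bound_mul_log]. *)
Lemma lim_mul_log2sinh : filterlim (fun z => z * log2sinh z) (at_right 0) (locally 0).
Proof.
  set (c := arcsinh (1 / 2)).
  assert (Ec : sinh c = 1 / 2) by apply sinh_arcsinh.
  assert (Hc : 0 < c).
  { destruct (Rle_lt_dec c 0) as [[H|H]|H]; [|rewrite H, sinh_0 in Ec; lra|exact H].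
    apply sinh_lt in H. rewrite sinh_0 in H. lra. }
  apply filterlim_ext with (fun z => z * ln (sinh z / sinh c) ^ 1).
  - intros z. unfold log2sinh. rewrite Ec, pow_1. in_R. f_equal. f_equal. field.
  - apply (filterlim_linear_bound_mul_log (fun z => z)); [exact Hc|].
    exists 1. split; [lra|]. intros t Ht. rewrite Rabs_pos_eq; lra.
Qed.

Lemma filterlim_real_plus {F : (R -> Prop) -> Prop} {FF : Filter F} (f g : R -> R) (a b : R) :
  filterlim f F (locally a) -> filterlim g F (locally b) ->
  filterlim (fun t => f t + g t) F (locally (a + b)).
Proof.
  intros Hf Hg. eapply filterlim_comp_2; [exact Hf | exact Hg |]. apply (filterlim_plus (V := R_NormedModule) a b).
Qed.

Lemma filterlim_real_mult {F : (R -> Prop) -> Prop} {FF : Filter F} (f g : R -> R) (a b : R) :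
  filterlim f F (locally a) -> filterlim g F (locally b) ->
  filterlim (fun t => f t * g t) F (locally (a * b)).
Proof.
  intros Hf Hg. eapply filterlim_comp_2; [exact Hf | exact Hg |]. apply (filterlim_mult (K := R_AbsRing) a b).
Qed.

Lemma filterlim_real_opp {F : (R -> Prop) -> Prop} {FF : Filter F} (f : R -> R) (a : R) :
  filterlim f F (locally a) -> filterlim (fun t => - f t) F (locally (- a)).
Proof.
  intros Hf. apply (filterlim_comp _ _ _ _ _ _ _ _ Hf).
  apply (filterlim_opp (V := R_NormedModule) a).
Qed.

Lemma filterlim_real_value {F : (R -> Prop) -> Prop} {FF : Filter F} (f : R -> R) (a b : R) :
  filterlim f F (locally a) -> a = b -> filterlim f F (locally b).
Proof. now intros H <-. Qed.

Lemma filterlim_real_id : filterlim (fun t : R => t) (at_right 0) (locally 0).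
Proof. apply (filterlim_at_right_of_continuous (fun t => t)); [apply continuous_id|reflexivity]. Qed.

(* The polylogarithmic functions are recognised syntactically: trying each limit lemma by
   unification would unfold the integrals that define them. *)
Ltac limits :=
  eapply filterlim_real_value;
  [ repeat lazymatch goal with
     | |- filterlim (fun z => z * log2sinh z) _ _ => apply lim_mul_log2sinh
     | |- filterlim (Li_1mexp _) _ _ => apply lim_Li_1mexp
     | |- filterlim (Li_1mexpN _) _ _ => apply lim_Li_1mexpN
     | |- filterlim (Li_expN _) _ _ => apply lim_Li_expN
     | |- filterlim (fun _ => ?c) _ _ => apply filterlim_const
     | |- filterlim (fun z => z) _ _ => apply filterlim_real_id
     | |- filterlim (fun z => @?f z + @?g z) _ _ => apply filterlim_real_plus
     | |- filterlim (Rmult ?c) _ _ => apply (filterlim_real_mult (fun _ => c) (fun z => z))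
     | |- filterlim (fun z => - @?f z) _ _ => apply filterlim_real_opp
     | |- filterlim (fun z => @?f z * @?g z) _ _ => apply filterlim_real_mult
     end
  | ].

Lemma eq_lim_of_derive_0 (f : R -> R) (l : R) :
  (forall t, 0 < t -> is_derive f t 0) -> filterlim f (at_right 0) (locally l) ->
  forall z, 0 < z -> f z = l.
Proof.
  intros Hf Hl z Hz.
  assert (Hc : filterlim f (at_right 0) (locally (f z))).
  { apply filterlim_ext_loc with (fun _ => f z); [|apply filterlim_const].
    generalize (at_right_between 0 z Hz). apply filter_imp. intros t Ht.
    destruct (MVT_gen f t z (fun _ => 0)) as [c [_ E]];
      rewrite ?Rmin_left, ?Rmax_right by lra.
    - intros x Hx. apply Hf. lra.
    - intros x Hx. apply continuity_pt_filterlim, (continuous_of_ex_derive f).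
      eexists. apply Hf. lra.
    - in_R. lra. }
  exact (filterlim_locally_unique _ _ _ Hc Hl).
Qed.

Lemma Derive_Li_1mexp (p : nat) (z : R) : 0 < z ->
  Derive (fun x => Li_1mexp (S p) x) z = Li_1mexp p z * (cosh z / sinh z + 1).
Proof. intros Hz. now apply is_derive_unique, is_derive_Li_1mexp. Qed.

Lemma Derive_Li_1mexpN (p : nat) (z : R) : 0 < z ->
  Derive (fun x => Li_1mexpN (S p) x) z = Li_1mexpN p z * (cosh z / sinh z - 1).
Proof. intros Hz. now apply is_derive_unique, is_derive_Li_1mexpN. Qed.

Lemma Derive_Li_expN (p : nat) (z : R) : 0 < z ->
  Derive (fun x => Li_expN (S p) x) z = -2 * Li_expN p z.
Proof. intros Hz. now apply is_derive_unique, is_derive_Li_expN. Qed.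

Lemma Derive_log2sinh (z : R) : 0 < z ->
  Derive (fun x => log2sinh x) z = cosh z / sinh z.
Proof. intros Hz. now apply is_derive_unique, is_derive_log2sinh. Qed.

(* Reduces [is_derive f z l], for [f] a polynomial in the functions above, to an algebraic
   identity, with the order-one polylogarithms replaced by their elementary expressions. *)
Ltac derive_Li Hz :=
  auto_derive;
  [ repeat match goal with |- _ /\ _ => split end;
    match goal with
    | |- True => exact I
    | |- ex_derive (fun x => Li_1mexp _ x) _ => eexists; apply (is_derive_Li_1mexp _ _ Hz)
    | |- ex_derive (fun x => Li_1mexpN _ x) _ => eexists; apply (is_derive_Li_1mexpN _ _ Hz)
    | |- ex_derive (fun x => Li_expN _ x) _ => eexists; apply (is_derive_Li_expN _ _ Hz)
    | |- ex_derive (fun x => log2sinh x) _ => eexists; apply (is_derive_log2sinh _ Hz)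
    end
  | rewrite ?(Derive_Li_1mexp _ _ Hz), ?(Derive_Li_1mexpN _ _ Hz), ?(Derive_Li_expN _ _ Hz),
      ?(Derive_log2sinh _ Hz);
    rewrite ?(Li_1mexp_0 _ Hz), ?(Li_1mexpN_0 _ Hz), ?(Li_expN_0 _ Hz) ].

(** Landen's relation: for [x = 1 - exp (2 z)] the other argument is [x / (x - 1)], and
    [- 2 z ^ 2] is [- ln (1 - x) ^ 2 / 2]. *)
Lemma dilog_two_term (z : R) : 0 < z -> Li_1mexp 1 z + Li_1mexpN 1 z + 2 * (z * z) = 0.
Proof.
  apply (eq_lim_of_derive_0 (fun z => Li_1mexp 1 z + Li_1mexpN 1 z + 2 * (z * z))).
  - intros t Ht. derive_Li Ht. ring.
  - limits. ring.
Qed.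

(** Euler's reflection formula for [x = exp (-2 z)], with [Li_2 (1 - x)] rewritten by
    Landen's relation so that the derivative is elementary. *)
Lemma dilog_three_term (z : R) : 0 < z ->
  Li_expN 1 z + - (1 / 2) * (Li_1mexp 1 z + - Li_1mexpN 1 z) + z * z + - (2 * (z * log2sinh z))
  = zeta 2.
Proof.
  apply (eq_lim_of_derive_0 (fun z =>
    Li_expN 1 z + - (1 / 2) * (Li_1mexp 1 z + - Li_1mexpN 1 z) + z * z + - (2 * (z * log2sinh z)))).
  - intros t Ht. derive_Li Ht. field. apply Rgt_not_eq, sinh_pos, Ht.
  - limits. replace (INR 2) with 2 by (simpl; ring). ring.
Qed.

(** Landen's relation for the trilogarithm, relating the arguments [x], [1 - x] and [1 - 1 / x] at
    [x = exp (-2 z)].  Its derivative vanishes by the two dilogarithm relations. *)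
Lemma trilog_three_term (z : R) : 0 < z ->
  Li_expN 2 z + Li_1mexp 2 z + Li_1mexpN 2 z + - (2 / 3) * (z * z * z) + 2 * (z * (z * log2sinh z))
   + 2 * zeta 2 * z = zeta 3.
Proof.
  apply (eq_lim_of_derive_0 (fun z => Li_expN 2 z + Li_1mexp 2 z + Li_1mexpN 2 z + - (2 / 3) * (z * z * z)
    + 2 * (z * (z * log2sinh z)) + 2 * zeta 2 * z)).
  - intros t Ht. derive_Li Ht.
    assert (H1 := dilog_two_term t Ht). assert (H2 := dilog_three_term t Ht).
    rewrite <- H2. replace (Li_1mexpN 1 t) with (- Li_1mexp 1 t - 2 * (t * t)) by lra.
    field. apply Rgt_not_eq, sinh_pos, Ht.
  - limits. replace (INR 3) with 3 by (simpl; ring). ring.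
Qed.

(** * The log-sinh integrals *)

(** The claimed values of [lsh (S j) 0] divided by [- (-1) ^ j * j!], that is
    [- lsh 1 0], [lsh 2 0], [- lsh 3 0 / 2] and [lsh 4 0 / 6].  Each is a primitive of [coth]
    times its predecessor.  A factor [z] is kept next to [log2sinh z], since only the product
    has a limit at [0+]. *)
Definition coth_primitives_0 (j : nat) (z : R) : R :=
  match j with
  | 0%nat => z
  | 1%nat => - (1 / 4) * (Li_1mexp 1 z + - Li_1mexpN 1 z)
  | 2%nat => - (1 / 2) * (1 / 3 * (z * z * z) + 1 / 2 * (Li_1mexp 2 z + - Li_1mexpN 2 z))
  | _ => 1 / 6 * (3 / 4 * (Li_expN 3 z + - 2 * Li_1mexp 3 z + 2 * Li_1mexpN 3 z)
           + 1 / 4 * (z * z * z * z) + - (z * z * (z * log2sinh z))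
           + - (3 / 4) * zeta 4 + 3 / 2 * zeta 3 * z + - (3 / 2) * zeta 2 * (z * z))
  end.

(** The claimed values of [lsh (S (S j)) 1] divided by [- (-1) ^ j * j!]. *)
Definition coth_primitives_1 (j : nat) (z : R) : R :=
  match j with
  | 0%nat => 1 / 2 * (z * z)
  | 1%nat => - (1 / 4) * (z * (Li_1mexp 1 z + - Li_1mexpN 1 z)) + 1 / 4 * (Li_1mexp 2 z + Li_1mexpN 2 z)
  | 2%nat => - (1 / 2) * (1 / 4 * (z * z * z * z) + 1 / 2 * (z * (Li_1mexp 2 z + - Li_1mexpN 2 z))
               + - (1 / 2) * (Li_1mexp 3 z + Li_1mexpN 3 z))
  | _ => 1 / 6 * (1 / 5 * (z * z * z * z * z) + - (3 / 4) * (z * z * z * (z * log2sinh z))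
           + - (3 / 8) * zeta 5 + 3 / 4 * zeta 3 * (z * z) + - zeta 2 * (z * z * z)
           + 3 / 4 * (z * (Li_expN 3 z + - 2 * Li_1mexp 3 z + 2 * Li_1mexpN 3 z))
           + 3 / 8 * (Li_expN 4 z + 4 * Li_1mexp 4 z + 4 * Li_1mexpN 4 z))
  end.

Lemma is_derive_coth_primitives_0 (j : nat) (t : R) : (j < 3)%nat -> 0 < t ->
  is_derive (coth_primitives_0 (S j)) t (cosh t / sinh t * coth_primitives_0 j t).
Proof.
  intros Hj Ht. assert (Hs : sinh t <> 0) by (apply Rgt_not_eq, sinh_pos, Ht).
  assert (H2 := dilog_two_term t Ht). assert (H3 := trilog_three_term t Ht).
  destruct j as [|[|[|j]]]; [| | |lia]; unfold coth_primitives_0; derive_Li Ht.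
  - field. exact Hs.
  - replace (Li_1mexpN 1 t) with (- Li_1mexp 1 t - 2 * (t * t)) by lra. field. exact Hs.
  - rewrite <- H3. field. exact Hs.
Qed.

Lemma is_derive_coth_primitives_1 (j : nat) (t : R) : (j < 3)%nat -> 0 < t ->
  is_derive (coth_primitives_1 (S j)) t (cosh t / sinh t * coth_primitives_1 j t).
Proof.
  intros Hj Ht. assert (Hs : sinh t <> 0) by (apply Rgt_not_eq, sinh_pos, Ht).
  assert (H2 := dilog_two_term t Ht). assert (H3 := trilog_three_term t Ht).
  destruct j as [|[|[|j]]]; [| | |lia]; unfold coth_primitives_1; derive_Li Ht.
  - replace (Li_1mexpN 1 t) with (- Li_1mexp 1 t - 2 * (t * t)) by lra. field. exact Hs.
  - replace (Li_1mexpN 1 t) with (- Li_1mexp 1 t - 2 * (t * t)) by lra. field. exact Hs.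
  - rewrite <- H3. field. exact Hs.
Qed.

Lemma INR_2_to_5 : INR 2 = 2 /\ INR 3 = 3 /\ INR 4 = 4 /\ INR 5 = 5.
Proof. repeat split; simpl; ring. Qed.

Lemma lim_coth_primitives_0 (j : nat) : (j < 3)%nat ->
  filterlim (coth_primitives_0 (S j)) (at_right 0) (locally 0).
Proof.
  intros Hj. destruct INR_2_to_5 as (E2 & E3 & E4 & E5).
  destruct j as [|[|[|j]]]; [| | |lia]; unfold coth_primitives_0; limits;
    rewrite ?E2, ?E3, ?E4, ?E5; ring.
Qed.

Lemma lim_coth_primitives_1 (j : nat) : (j < 3)%nat ->
  filterlim (coth_primitives_1 (S j)) (at_right 0) (locally 0).
Proof.
  intros Hj. destruct INR_2_to_5 as (E2 & E3 & E4 & E5).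
  destruct j as [|[|[|j]]]; [| | |lia]; unfold coth_primitives_1; limits;
    rewrite ?E2, ?E3, ?E4, ?E5; ring.
Qed.

Lemma lsh_coth_primitives_0 (p : nat) (z : R) : 0 < z -> (p <= 3)%nat ->
  lsh (S p) 0 z = - ((-1) ^ p * INR (fact p) * coth_primitives_0 p z).
Proof.
  intros Hz Hp. replace p with (S p - 1 - 0)%nat at 2 3 4 by lia.
  apply lsh_eq; [exact Hz | | |].
  - intros t. simpl. field.
  - intros j t Hj. apply is_derive_coth_primitives_0. lia.
  - intros j Hj. apply lim_coth_primitives_0. lia.
Qed.

Lemma lsh_coth_primitives_1 (p : nat) (z : R) : 0 < z -> (p <= 3)%nat ->
  lsh (S (S p)) 1 z = - ((-1) ^ p * INR (fact p) * coth_primitives_1 p z).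
Proof.
  intros Hz Hp. replace p with (S (S p) - 1 - 1)%nat at 2 3 4 by lia.
  apply lsh_eq; [exact Hz | | |].
  - intros t. simpl. field.
  - intros j t Hj. apply is_derive_coth_primitives_1. lia.
  - intros j Hj. apply lim_coth_primitives_1. lia.
Qed.

Open Scope C_scope.

Theorem corollary5p2 : forall z : R, (0 < z)%R ->
  RtoC (lsh 3 1 z) =
    - (z / 4) * (Li 2 (1 - exp (2 * z)) - Li 2 (1 - exp (-2 * z)))
    + 1 / 4 * (Li 3 (1 - exp (2 * z)) + Li 3 (1 - exp (-2 * z)))
  /\
  RtoC (lsh 4 1 z) =
    z ^ 4 / 4
    + z / 2 * (Li 3 (1 - exp (2 * z)) - Li 3 (1 - exp (-2 * z)))
    - 1 / 2 * (Li 4 (1 - exp (2 * z)) + Li 4 (1 - exp (-2 * z)))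
  /\
  RtoC (lsh 5 1 z) =
    z ^ 5 / 5 - 3 * z ^ 4 / 4 * ln (2 * sinh z)
    - 3 / 8 * zeta 5 + 3 * z ^ 2 / 4 * zeta 3 - z ^ 3 * zeta 2
    + 3 * z / 4 * (Li 4 (exp (-2 * z)) - 2 * Li 4 (1 - exp (2 * z))
                   + 2 * Li 4 (1 - exp (-2 * z)))
    + 3 / 8 * (Li 5 (exp (-2 * z)) + 4 * Li 5 (1 - exp (2 * z))
               + 4 * Li 5 (1 - exp (-2 * z)))
  /\
  RtoC (lsh 3 0 z) =
    z ^ 3 / 3
    + 1 / 2 * (Li 3 (1 - exp (2 * z)) - Li 3 (1 - exp (-2 * z)))
  /\
  RtoC (lsh 4 0 z) =
    3 / 4 * (Li 4 (exp (-2 * z)) - 2 * Li 4 (1 - exp (2 * z))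
             + 2 * Li 4 (1 - exp (-2 * z)))
    + z ^ 4 / 4 - z ^ 3 * ln (2 * sinh z)
    - 3 / 4 * zeta 4 + 3 * z / 2 * zeta 3 - 3 * z ^ 2 / 2 * zeta 2.
Proof.
  intros z Hz. destruct (exp_bounds z Hz) as [H1 [H2 H3]].
  assert (EA : forall p, Li (S p) (1 - exp (2 * z)) = RtoC (Li_1mexp p z)).
  { intros p. rewrite <- RtoC_minus. apply Li_RtoC. lra. }
  assert (EB : forall p, Li (S p) (1 - exp (-2 * z)) = RtoC (Li_1mexpN p z)).
  { intros p. rewrite <- RtoC_minus. apply Li_RtoC. lra. }
  assert (EC : forall p, Li (S p) (exp (-2 * z)) = RtoC (Li_expN p z)).
  { intros p. apply Li_RtoC. lra. }
  rewrite !EA, !EB, !EC. change (ln (2 * sinh z)) with (log2sinh z).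
  rewrite !(lsh_coth_primitives_1 _ z Hz), !(lsh_coth_primitives_0 _ z Hz) by lia.
  repeat first
    [ rewrite <- RtoC_pow | rewrite <- RtoC_mult | rewrite <- RtoC_plus
    | rewrite <- RtoC_minus | rewrite <- RtoC_opp | rewrite <- RtoC_div by lra ].
  repeat split; f_equal; simpl; field.
Qed.
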